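(* For a real analytic function $f:\mathbb{R}\to\mathbb{R}$ let $\mathcal{M}_f=(\mathbb{R}^4,g_f)$, where, in coordinates $(x,y,\tilde x,\tilde y)$, the non-zero components (up to symmetry) of $g_f$ are $g_f(\partial_x,\partial_x)=-2f(y)$ and $g_f(\partial_x,\partial_{\tilde x})=g_f(\partial_y,\partial_{\tilde y})=1$. Let $\mathcal{C}_2(\mathbb{R})$ be the set of real analytic $f:\mathbb{R}\to\mathbb{R}$ with $f^{(2)}>0$ everywhere, and $\mathcal{C}_3(\mathbb{R})$ the set of those with $f^{(2)}>0$ and $f^{(3)}>0$ everywhere. For $f\in\mathcal{C}_3(\mathbb{R})$ and $p\ge2$ set $\alpha_p(f):=f^{(p+2)}\{f^{(2)}\}^{p-1}\{f^{(3)}\}^{-p}$. Then: (1) If $f\in\mathcal{C}_2(\mathbb{R})$, then $\mathcal{M}_f$ is $0$-modeled on the irreducible symmetric space $\mathcal{M}_{y^2}$. (2) If $f\in\mathcal{C}_3(\mathbb{R})$, then $\mathcal{M}_f$ is $1$-modeled on the homogeneous space $\mathcal{M}_{e^y}$. (3) Let $f_1,f_2\in\mathcal{C}_3(\mathbb{R})$ and let $P_1,P_2\in\mathbb{R}^4$. The following assertions are equivalent: (a) There exists an isometry $\phi:\mathcal{M}_{f_1}\to\mathcal{M}_{f_2}$ with $\phi(P_1)=P_2$. (b) $\alpha_p(f_1)(P_1)=\alpha_p(f_2)(P_2)$ for all $p\ge2$.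
   Context: $f^{(j)}$ denotes the $j$-th derivative. A function of $y$, such as $\alpha_p(f)$, is evaluated at a point $P=(x,y,\tilde x,\tilde y)\in\mathbb{R}^4$ by evaluating it at the $y$-coordinate of $P$. $\mathcal{M}_{y^2}$ and $\mathcal{M}_{e^y}$ are the manifolds $\mathcal{M}_f$ with $f(y)=y^2$ and $f(y)=e^y$. For a pseudo-Riemannian manifold $\mathcal{M}=(M,g)$ and $P\in M$ let $\mathcal{U}^k_{\mathcal{M},P}:=(T_PM,g|_{T_PM},R|_{T_PM},\nabla R|_{T_PM},\dots,\nabla^kR|_{T_PM})$, where $\nabla^iR\in\otimes^{4+i}T^*M$ is the $i$-th covariant derivative of the curvature tensor. A tuple $\mathcal{U}^k=(V,\langle\cdot,\cdot\rangle,A^0,\dots,A^k)$ consisting of a finite dimensional real vector space $V$ with a non-degenerate inner product and tensors $A^i\in\otimes^{4+i}V^*$ is a $k$-model for $\mathcal{M}$ if for every $P\in M$ there is a linear isomorphism $\Phi_P:T_PM\to V$ with $\Phi_P^*\langle\cdot,\cdot\rangle=g|_{T_PM}$ and $\Phi_P^*A^i=\nabla^iR|_{T_PM}$ for $0\le i\le k$. $\mathcal{M}$ is $k$-modeled on a homogeneous space $\mathcal{N}$ if there exists $Q\in N$ such that $\mathcal{U}^k_{\mathcal{N},Q}$ is a $k$-model for $\mathcal{M}$. Homogeneous means that the isometry group acts transitively; symmetric means $\nabla R=0$ (for complete simply connected manifolds such as $\mathcal{M}_{y^2}$). Irreducible means not locally a non-trivial pseudo-Riemannian product, i.e. the holonomy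 group leaves invariant no non-degenerate proper non-zero subspace of a tangent space. *)

(* Defs.v *)
From HB Require Import structures.
From mathcomp Require Import all_boot all_order all_algebra.
From mathcomp Require Import all_classical all_reals all_analysis.

Set Implicit Arguments.
Unset Strict Implicit.
Unset Printing Implicit Defensive.

Import Order.TTheory GRing.Theory Num.Theory.
Import numFieldNormedType.Exports.

Local Open Scope ring_scope.
Local Open Scope classical_set_scope.

Section PseudoRiemannian.
Variables (R : realType) (n : nat).

(* The manifold is R^n = 'rV[R]_n with its global chart, and every tangent
   space is identified with 'rV[R]_n through the coordinate frame.  A metric is
   given by its matrix in that frame; it is meant to be smooth, symmetric and
   invertible at every point. *)
Definition metric := 'rV[R]_n -> 'M[R]_n.

Definition ip (G : 'M[R]_n) (u v : 'rV[R]_n) : R := (u *m G *m v^T) 0 0.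

Definition partial (W : normedModType R) (i : 'I_n) (F : 'rV[R]_n -> W) :
  'rV[R]_n -> W := fun P => 'D_(delta_mx 0 i) F P.

(* C^oo: all iterated partial derivatives exist and are differentiable (hence
   continuous). *)
Definition smooth (W : normedModType R) (F : 'rV[R]_n -> W) :=
  forall (s : seq 'I_n) (P : 'rV[R]_n),
    differentiable (foldr (@partial W) F s) P.

Definition metric_isometry (g1 g2 : metric) (phi : 'rV[R]_n -> 'rV[R]_n) :=
  [/\ smooth phi,
      exists psi, [/\ smooth psi, cancel phi psi & cancel psi phi]
    & forall P u v : 'rV[R]_n,
        ip (g2 (phi P)) ('d phi P u) ('d phi P v) = ip (g1 P) u v].

Definition homogeneous (g : metric) :=
  forall P Q : 'rV[R]_n, exists2 phi, metric_isometry g g phi & phi P = Q.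

(* christoffel g i j k is the coefficient of d_k in nabla_(d_i) d_j. *)
Definition christoffel (g : metric) (i j k : 'I_n) (P : 'rV[R]_n) : R :=
  2^-1 * \sum_(l < n) invmx (g P) k l *
    (partial i (fun Q => g Q j l) P + partial j (fun Q => g Q i l) P
     - partial l (fun Q => g Q i j) P).

(* The coefficient of d_l in
   nabla_(d_i) nabla_(d_j) d_k - nabla_(d_j) nabla_(d_i) d_k. *)
Definition curvature (g : metric) (i j k l : 'I_n) (P : 'rV[R]_n) : R :=
  partial i (christoffel g j k l) P - partial j (christoffel g i k l) P
  + \sum_(m < n) (christoffel g j k m P * christoffel g i m l P
                  - christoffel g i k m P * christoffel g j m l P).

(* Components of a covariant tensor field of rank r. *)
Definition tensor (r : nat) := r.-tuple 'I_n -> 'rV[R]_n -> R.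

Definition riemann (g : metric) : tensor 4 := fun s P =>
  \sum_(m < n) curvature g (tnth s 0) (tnth s 1) (tnth s 2) m P
               * g P m (tnth s 3).

Definition set_tnth (r : nat) (s : r.-tuple 'I_n) (j : 'I_r) (m : 'I_n) :
  r.-tuple 'I_n := [tuple if k == j then m else tnth s k | k < r].

(* The differentiation index comes first:
   (nabla T)(X_0, X_1, ..., X_r) = (nabla_(X_0) T)(X_1, ..., X_r). *)
Definition cov (g : metric) (r : nat) (T : tensor r) : tensor r.+1 := fun s P =>
  let i := thead s in let t := [tuple of behead s] in
  partial i (T t) P
  - \sum_(j < r) \sum_(m < n)
      christoffel g i (tnth t j) m P * T (set_tnth t j m) P.

Fixpoint nabla_riemann (g : metric) (k : nat) : tensor (4 + k) :=
  if k is k'.+1 then cov g (@nabla_riemann g k') else riemann g.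
Arguments nabla_riemann : clear implicits.

Definition tensor_eval (r : nat) (T : tensor r) (P : 'rV[R]_n)
    (v : 'I_r -> 'rV[R]_n) : R :=
  \sum_(s : r.-tuple 'I_n) T s P * \prod_(j < r) v j 0 (tnth s j).

Definition smooth_curve (c : R -> 'rV[R]_n) :=
  forall (k : nat) (t : R), derivable (derive1n k c) t 1.

Definition parallel_along (g : metric) (c X : R -> 'rV[R]_n) :=
  forall t : R, derivable X t 1 /\
    forall k : 'I_n, derive1 X t 0 k
      + \sum_(i < n) \sum_(j < n)
          christoffel g i j k (c t) * derive1 c t 0 i * X t 0 j = 0.

Definition geodesic (g : metric) (c : R -> 'rV[R]_n) :=
  (forall t : R, derivable c t 1) /\ parallel_along g c (derive1 c).

Definition geodesically_complete (g : metric) :=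
  forall P v : 'rV[R]_n,
    exists c : R -> 'rV[R]_n, [/\ geodesic g c, c 0 = P & derive1 c 0 = v].

(* R^n being simply connected, a complete metric with nabla R = 0 is
   (globally) symmetric. *)
Definition symmetric_space (g : metric) :=
  geodesically_complete g /\
  forall (s : (4 + 1).-tuple 'I_n) (P : 'rV[R]_n), nabla_riemann g 1 s P = 0.

(* parallel_transport g P Q A: the map v |-> v *m A is the parallel transport
   from T_P to T_Q along a piecewise smooth curve, that is, along a
   concatenation of restrictions to [0, 1] of smooth curves. *)
Inductive parallel_transport (g : metric) :
    'rV[R]_n -> 'rV[R]_n -> 'M[R]_n -> Prop :=
| Transport_smooth (c : R -> 'rV[R]_n) (A : 'M[R]_n) of
    smooth_curve c
  & (forall v : 'rV[R]_n, exists X : R -> 'rV[R]_n,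
       [/\ parallel_along g c X, X 0 = v & X 1 = v *m A]) :
    parallel_transport g (c 0) (c 1) A
| Transport_concat (P Q S : 'rV[R]_n) (A B : 'M[R]_n) of
    parallel_transport g P Q A & parallel_transport g Q S B :
    parallel_transport g P S (A *m B).

Definition holonomy (g : metric) (P : 'rV[R]_n) (A : 'M[R]_n) :=
  parallel_transport g P P A.

Definition nondegenerate_on (G : 'M[R]_n) (W : {vspace 'rV[R]_n}) :=
  forall w, w \in W -> (forall u, u \in W -> ip G w u = 0) -> w = 0.

Definition irreducible (g : metric) :=
  forall (P : 'rV[R]_n) (W : {vspace 'rV[R]_n}),
    nondegenerate_on (g P) W ->
    (forall A, holonomy g P A -> forall w, w \in W -> w *m A \in W) ->
    W = 0%VS \/ W = fullv.

End PseudoRiemannian.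

Arguments nabla_riemann {R n} g k s P.

Section Models.
Variable R : realType.

(* The data (V, <.,.>, A^0, ..., A^k). *)
Record model (k : nat) := Model {
  mspace : vectType R;
  minner : mspace -> mspace -> R;
  mtensor : forall i : 'I_k.+1, ('I_(4 + i) -> mspace) -> R }.

Arguments minner {k} m x y.
Arguments mtensor {k} m i v.

Definition multilinear (V : vectType R) (r : nat) (T : ('I_r -> V) -> R) :=
  forall (v : 'I_r -> V) (j : 'I_r) (a : R) (x y : V),
    T [eta v with j |-> a *: x + y]
    = a * T [eta v with j |-> x] + T [eta v with j |-> y].

Definition is_model (k : nat) (U : model k) :=
  [/\ forall x y, minner U x y = minner U y x,
      forall a x y z,
        minner U (a *: x + y) z = a * minner U x z + minner U y z,
      forall x, (forall y, minner U x y = 0) -> x = 0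
    & forall i, multilinear (mtensor U i)].

Definition model_of (n k : nat) (g : metric R n) (Q : 'rV[R]_n) : model k :=
  @Model k 'rV[R]_n (ip (g Q))
    (fun i => tensor_eval (nabla_riemann g i) Q).

Definition is_model_for (n k : nat) (U : model k) (g : metric R n) :=
  is_model U /\
  forall P : 'rV[R]_n, exists Phi : {linear 'rV[R]_n -> mspace U},
    [/\ bijective Phi,
        forall u v, minner U (Phi u) (Phi v) = ip (g P) u v
      & forall (i : 'I_k.+1) (v : 'I_(4 + i) -> 'rV[R]_n),
          mtensor U i (Phi \o v) = tensor_eval (nabla_riemann g i) P v].

Definition modeled_on (n m k : nat) (g : metric R n) (h : metric R m) :=
  homogeneous h /\ exists Q : 'rV[R]_m, is_model_for (model_of k h Q) g.

End Models.

Section Family.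
Variable R : realType.

Definition real_analytic (f : R -> R) :=
  forall y0 : R, exists (a : R^nat) (r : R), 0 < r /\
    forall y : R, `|y - y0| < r -> pseries a (y - y0) @ \oo --> f y.

Definition ycoord (P : 'rV[R]_4) : R := P 0 1.

(* The coordinates (x, y, x~, y~) have indices 0, 1, 2, 3. *)
Definition Mf (f : R -> R) : metric R 4 := fun P =>
  \matrix_(i < 4, j < 4)
    match nat_of_ord i, nat_of_ord j with
    | 0%N, 0%N => - 2 * f (ycoord P)
    | 0%N, 2%N | 2%N, 0%N | 1%N, 3%N | 3%N, 1%N => 1
    | _, _ => 0
    end.

Definition C2 (f : R -> R) :=
  real_analytic f /\ forall y, 0 < derive1n 2 f y.

Definition C3 (f : R -> R) :=
  [/\ real_analytic f, forall y, 0 < derive1n 2 f y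
    & forall y, 0 < derive1n 3 f y].

Definition alpha (p : nat) (f : R -> R) (y : R) : R :=
  derive1n (p + 2) f y * derive1n 2 f y ^+ (p - 1) * derive1n 3 f y ^- p.

End Family.

(* Main.v *)
(* In the frame (d_x, d_y, d_x~, d_y~) the connection of M_f is linear in f'
   and the k-th covariant derivative of the curvature has the single component
   R(x,y,y,x;y,...,y) = f^(k+2).  The frame change d_x -> a d_x + b d_x~,
   d_y -> d d_y, d_x~ -> d_x~ / a, d_y~ -> d_y~ / d multiplies it by
   a^2 d^(k+2) and b is free to fix the metric, which gives (1) and (2); the
   manifold M_(y^2) is irreducible because some loop has the holonomy
   1 + N with N non-degenerate from span(d_x, d_y) onto span(d_x~, d_y~).
   For (3), an isometry phi = (X, Y, X~, Y~) intertwines the connections, and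
   the integrability conditions of this second order system make X and Y affine
   and force f1''(y) = c f2''(Y) with c constant and Y_y constant, hence
   f1^(n+2)(y) = c d^n f2^(n+2)(Y), which leaves every alpha_p unchanged.
   Conversely, equality of all the alpha_p at P1, P2 says that f1'' and
   t -> a^2 d^2 f2''(d t + e) have the same Taylor series at y(P1); by
   analyticity f1 = a^2 f2(d t + e) + b t + c, and an explicit quadratic map is
   the isometry. *)
Require Import Defs.
From HB Require Import structures.
From mathcomp Require Import all_boot all_order all_algebra.
From mathcomp Require Import all_classical all_reals all_analysis.
From mathcomp Require Import ring lra.

Import Order.TTheory GRing.Theory Num.Theory.
Import numFieldNormedType.Exports.

Local Open Scope ring_scope.
Local Open Scope classical_set_scope.

(** * Real analytic functions *)

Section RealAnalytic.
Context {R : realType}.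
Implicit Types (f g : R -> R) (a b : R^nat).

(* Comparison: (n+1) z^n <= (w^(n+1) - z^(n+1)) / (w - z) for 0 <= z < w. *)
Lemma is_cvg_pseries_diffs_inside a (x z : R) :
  cvgn (pseries a x) -> `|z| < `|x| -> cvgn (pseries (pseries_diffs a) z).
Proof.
move=> Cx zx.
pose w := (`|z| + `|x|) / 2.
have zw : `|z| < w by rewrite /w; lra.
have wx : w < `|x| by rewrite /w; lra.
have w0 : 0 <= w by apply: le_trans (normr_ge0 z) (ltW zw).
have Cw : cvgn (pseries (fun i => `|a i|) w).
  by apply: is_cvg_pseries_inside_norm Cx _; rewrite ger0_norm.
apply: normed_cvg.
apply: (@series_le_cvg _ _ (fun n => (`|a n.+1| * w ^+ n.+1) / (w - `|z|))) => //=.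
- by move=> n; rewrite mulr_ge0// ?invr_ge0 ?subr_ge0 ?(ltW zw)// mulr_ge0// exprn_ge0.
- move=> n; rewrite /pseries_diffs !normrM normrX normr_nat.
  rewrite ler_pdivlMr ?subr_gt0// (mulrC n.+1%:R) -!mulrA ler_wpM2l//.
  have : `|z| ^+ n *+ n.+1 <= \sum_(i < n.+1) w ^+ (n - i) * `|z| ^+ i.
    rewrite -[in X in X <= _](card_ord n.+1) -sumr_const; apply: ler_sum => i _.
    have {1}-> : n = ((n - i) + i)%N by rewrite subnK// -ltnS.
    by rewrite exprD ler_wpM2r ?exprn_ge0// lerXn2r// ?nnegrE// ltW.
  move=> /(ler_wpM2l (ltW (_ : 0 < w - `|z|))); rewrite subr_gt0 => /(_ zw).
  rewrite -subrXX -mulr_natl => h.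
  rewrite mulrA mulrC (le_trans h)// lerBlDr lerDl exprn_ge0//.
- rewrite (_ : (fun n => _) = (w - `|z|)^-1 *: (fun n => `|a n.+1| * w ^+ n.+1)).
    apply: is_cvg_seriesZ.
    have /= := Cw; rewrite /pseries.
    move/cvg_ex => [l hl]; apply/cvg_ex; exists (l - `|a 0|).
    rewrite (_ : series _ = fun n => [series `|a i| * w ^+ i]_i n.+1 - `|a 0|).
      by apply: cvgB; [rewrite cvg_shiftS|exact: cvg_cst].
    by apply/funext => n; rewrite /series/= big_nat_recl// expr0 mulr1 addrC addKr.
  by apply/funext => n; rewrite /= mulrC.
Qed.

(** The local condition inside [real_analytic] with its series and radius made explicit:
    differentiation then acts on the coefficients and keeps the radius [r]. *)
Definition expands f (y0 : R) a (r : R) :=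
  forall y : R, `|y - y0| < r -> pseries a (y - y0) @ \oo --> f y.

Lemma expands_is_derive {f y0 a r} y : expands f y0 a r -> `|y - y0| < r ->
  is_derive y 1 f (limn (pseries (pseries_diffs a) (y - y0)))
  /\ pseries (pseries_diffs a) (y - y0) @ \oo --> f^`() y.
Proof.
move=> fa yr.
have cv (z : R) : `|z| < r -> cvgn (pseries a z).
  move=> zr; apply/cvg_ex; exists (f (z + y0)).
  by have := fa (z + y0); rewrite addrK => /(_ zr).
(* Term-by-term differentiation at [y - y0] needs the series of [a] and of its first two formal
   derivatives to converge at one farther point. Each formal derivative costs a slightly smaller
   radius, hence the chain [K2 < K1 < K0 < r]. *)
pose K0 := (`|y - y0| + r) / 2.
pose K1 := (`|y - y0| + K0) / 2.
pose K2 := (`|y - y0| + K1) / 2.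
have yK0 : `|y - y0| < K0 by rewrite /K0; lra.
have yK1 : `|y - y0| < K1 by rewrite /K1; lra.
have yK2 : `|y - y0| < K2 by rewrite /K2; lra.
have K12 : K2 < K1 by rewrite /K2; lra.
have K01 : K1 < K0 by rewrite /K1; lra.
have K0r : K0 < r by rewrite /K0; lra.
have n0 := normr_ge0 (y - y0).
have nK0 : `|K0| = K0 by rewrite ger0_norm//; lra.
have nK1 : `|K1| = K1 by rewrite ger0_norm//; lra.
have nK2 : `|K2| = K2 by rewrite ger0_norm//; lra.
have c0 : cvgn (pseries a K0) by apply: cv; rewrite nK0.
have c1 : cvgn (pseries (pseries_diffs a) K1).
  by apply: is_cvg_pseries_diffs_inside c0 _; rewrite nK0 nK1.
have c2 : cvgn (pseries (pseries_diffs (pseries_diffs a)) K2).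
  by apply: is_cvg_pseries_diffs_inside c1 _; rewrite nK2 nK1.
have := @pseries_snd_diffs _ a K2 (y - y0).
move=> /(_ (is_cvg_pseries_inside c0 _)); rewrite nK0 nK2 => /(_ (lt_trans K12 K01)).
move=> /(_ (is_cvg_pseries_inside c1 _)); rewrite nK1 nK2 => /(_ K12 c2 yK2) hd.
have hd' : is_derive y 1 f (limn (pseries (pseries_diffs a) (y - y0))).
  have : is_derive y 1 ((fun x => limn (pseries a x)) \o (fun z => z - y0))
     (1 * limn (pseries (pseries_diffs a) (y - y0))).
    rewrite mulrC; apply: is_derive1_comp.
    exact: is_derive_shift.
  rewrite mul1r.
  apply: near_eq_is_derive; rewrite ?oner_neq0//.
  near=> z; rewrite /=.
  apply: cvg_lim => //; apply: fa.
  near: z.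
  have : 0 < r - `|y - y0| by lra.
  move=> e0; apply/nbhs_ballP; exists (r - `|y - y0|) => //= z.
  rewrite /ball/= => h.
  by have := ler_distD y z y0; rewrite (distrC z y); lra.
split=> //.
rewrite derive1E (@derive_val _ _ _ _ _ _ _ hd').
by apply: is_cvg_pseries_inside c1 _; rewrite nK1.
Unshelve. all: by end_near. Qed.

Lemma expands_derive1 {f y0 a r} :
  expands f y0 a r -> expands f^`() y0 (pseries_diffs a) r.
Proof. by move=> fa y yr; have [_] := expands_is_derive y fa yr. Qed.

Lemma real_analytic_derivable f (y : R) : real_analytic f -> derivable f y 1.
Proof.
move=> /(_ y)[a [r [r0 fa]]].
have yr : `|y - y| < r by rewrite subrr normr0.
by have [[h _] _] := expands_is_derive y fa yr; exact: h.
Qed.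

Lemma real_analytic_derive1 f : real_analytic f -> real_analytic f^`().
Proof.
move=> fa y0; have [a [r [r0 {}fa]]] := fa y0.
by exists (pseries_diffs a), r; split=> //; exact: (expands_derive1 fa).
Qed.

Lemma real_analytic_derive1n f n : real_analytic f -> real_analytic f^`(n).
Proof. by move=> fa; elim: n => // n; exact: real_analytic_derive1. Qed.

Lemma expands_center {f y0 a r} : 0 < r -> expands f y0 a r -> f y0 = a 0.
Proof.
move=> r0 /(_ y0); rewrite subrr normr0 => /(_ r0) h.
apply: (cvg_unique _ h) => //.
(* The partial sum of index 0 is empty; from index 1 on all of them equal [a 0]. *)
rewrite /= -cvg_shiftS.
rewrite (_ : [sequence _]_n = cst (a 0)); first exact: cvg_cst.
apply/funext => n; rewrite /pseries /series/= big_nat_recl// expr0 mulr1.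
by rewrite big1 ?addr0// => i _; rewrite expr0n mulr0.
Qed.

Lemma expands_coef {f y0 a r} n :
  0 < r -> expands f y0 a r -> f^`(n) y0 = n`!%:R * a n.
Proof.
move=> r0; elim: n f a => [|n IH] f a fa; first by rewrite mul1r -(expands_center r0 fa).
rewrite derive1Sn (IH _ _ (expands_derive1 fa)) /pseries_diffs mulrA.
by rewrite factS natrM [in RHS](mulrC n.+1%:R).
Qed.

Lemma derive1n_eq_near f g (y0 : R) n :
  (\near y0, f y0 = g y0) -> (\near y0, f^`(n) y0 = g^`(n) y0).
Proof.
elim: n => // n IH /IH {}IH.
move/near_join: IH; apply: filterS => y h.
by rewrite !derive1nS !derive1E; apply: near_eq_derive; rewrite ?oner_neq0.
Qed.

(** The set [Z] of points where all derivatives agree is open, because equal derivatives give equal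
    Taylor coefficients, and closed, as an intersection of zero sets of continuous functions. It
    contains [y0], so it is the whole connected line. *)
Lemma real_analytic_eq f g (y0 : R) : real_analytic f -> real_analytic g ->
  (forall n, f^`(n) y0 = g^`(n) y0) -> f = g.
Proof.
move=> fa ga h0.
pose Z : set R := [set y | forall n, f^`(n) y = g^`(n) y].
have Zopen : open Z.
  rewrite openE => y hy; rewrite /interior.
  have [a [r [r0 ar]]] := fa y.
  have [b [s [s0 bs]]] := ga y.
  suff : \forall z \near y, f z = g z.
    move=> h; have : \near y, forall n : nat, f^`(n) y = g^`(n) y.
      move/near_join : h; apply: filterS => z hz n.
      by have /nbhs_singleton := @derive1n_eq_near f g z n hz.
    exact.
  have ab : a = b.
    apply/funext => n; have := hy n.
    rewrite (expands_coef n r0 ar) (expands_coef n s0 bs).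
    by apply: mulfI; rewrite pnatr_eq0 -lt0n fact_gt0.
  near=> z.
  have zr : `|z - y| < r by rewrite distrC; near: z; exact: nbhsx_ballx.
  have zs : `|z - y| < s by rewrite distrC; near: z; exact: nbhsx_ballx.
  apply: (cvg_unique _ (ar z zr)) => //; rewrite ab; exact: bs.
have Zclosed : closed Z.
  rewrite (_ : Z = \bigcap_n (derive1n n f - derive1n n g) @^-1` [set 0]).
    apply: closed_bigI => n _.
    apply: preimage_closed; last exact: closed_eq.
    move=> y _.
    have : derivable (derive1n n f - derive1n n g) y 1.
      by apply: derivableB; apply: real_analytic_derivable; exact: real_analytic_derive1n.
    by move=> /derivable1_diffP/differentiable_continuous.
  apply/seteqP; split=> [y hy n _|y hy n].
    by have : derive1n n f y - derive1n n g y = 0 by rewrite hy subrr.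
  by have /subr0_eq : derive1n n f y - derive1n n g y = 0 by exact: hy.
have ZT : Z = setT.
  have /(_ Z) := (connected_intervalP [set: R]).2 (fun _ _ _ _ _ _ => I).
  apply.
  - by exists y0.
  - by exists Z => //; rewrite setTI.
  - by exists Z => //; rewrite setTI.
apply/funext => y; have : Z y by rewrite ZT.
by move=> /(_ 0%N).
Unshelve. all: by end_near. Qed.

Lemma derive1n_affine f (c d e y : R) n : (forall m (z : R), derivable f^`(m) z 1) ->
  (fun t => c * f (d * t + e))^`(n) y = c * d ^+ n * derive1n n f (d * y + e).
Proof.
move=> df; elim: n y => [|n IH] y; first by rewrite mulr1.
rewrite derive1nS.
rewrite (_ : derive1n n _ = fun y => c * d ^+ n * derive1n n f (d * y + e)); last first.
  by apply/funext => z; rewrite IH.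
rewrite derive1E.
have h : is_derive (d * y + e : R) 1 f^`(n) (f^`(n.+1) (d * y + e)).
  by apply: DeriveDef; [exact: df|rewrite derive1nS derive1E].
have h1 : is_derive y 1 (fun y : R => d * y + e) d.
  have -> : (fun y : R => d * y + e) = (d *: id) + cst e by [].
  by apply: is_derive_eq; rewrite addr0 [_ *: _]mulr1.
have h2 := @is_derive1_comp R f^`(n) (fun y => d * y + e) y _ _ h h1.
have h3 := is_deriveZ (c * d ^+ n) h2.
rewrite (@derive_val _ _ _ _ _ _ _ h3) exprSr.
by rewrite [_ *: _]mulrA mulrAC mulrA.
Qed.

Lemma real_analytic_affine f (c d e : R) : real_analytic f ->
  real_analytic (fun t => c * f (d * t + e)).
Proof.
move=> fa y0; have [a [r [r0 ar]]] := fa (d * y0 + e).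
(* Adding 1 to the absolute value of [d] keeps the radius meaningful when [d] is 0. *)
exists (fun n => c * (a n * d ^+ n)), (r / (`|d| + 1)).
have d0 : 0 < `|d| + 1 by rewrite ltr_pwDr.
split; first by rewrite divr_gt0.
move=> y; rewrite ltr_pdivlMr// => yr.
have := ar (d * y + e).
rewrite (_ : d * y + e - _ = d * (y - y0)); last by ring.
have h : `|d * (y - y0)| < r.
  by rewrite normrM (le_lt_trans _ yr)// mulrC ler_wpM2l// lerDl.
move=> /(_ h) {}h.
rewrite (_ : pseries _ _ = c *: pseries a (d * (y - y0))); first exact: cvgZr.
apply/funext => n; rewrite /pseries /series/= fctE /= scaler_sumr.
by apply: eq_bigr => i _; rewrite exprMn -mulrA -mulrA; congr (_ * _); rewrite -mulrA.
Qed.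

End RealAnalytic.

(** * Connection and curvature of the metrics *)

Local Notation i0 := (@Ordinal 4 0 isT).
Local Notation i1 := (@Ordinal 4 1 isT).
Local Notation i2 := (@Ordinal 4 2 isT).
Local Notation i3 := (@Ordinal 4 3 isT).

Lemma ord4_ind (P : 'I_4 -> Prop) : P i0 -> P i1 -> P i2 -> P i3 -> forall i, P i.
Proof.
move=> h0 h1 h2 h3 [[|[|[|[|i]]]] hi] //.
- by rewrite (_ : Ordinal hi = i0)//; exact: val_inj.
- by rewrite (_ : Ordinal hi = i1)//; exact: val_inj.
- by rewrite (_ : Ordinal hi = i2)//; exact: val_inj.
- by rewrite (_ : Ordinal hi = i3)//; exact: val_inj.
Qed.

Lemma big_ord4 (V : nmodType) (F : 'I_4 -> V) :
  \sum_(l < 4) F l = F i0 + F i1 + F i2 + F i3.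
Proof.
rewrite !big_ord_recl big_ord0 addr0 !addrA.
by congr (F _ + F _ + F _ + F _); exact: val_inj.
Qed.

Section MetricFamily.
Context {R : realType}.
Implicit Types (f : R -> R) (P : 'rV[R]_4) (i j k l : 'I_4).

Lemma ycoordE P : ycoord P = P 0 i1.
Proof. by rewrite /ycoord; congr (P _ _); exact: val_inj. Qed.

Lemma partial_ycoord (F : R -> R) i P :
  partial i (fun Q => F (ycoord Q)) P = (i == i1)%:R * derive1 F (ycoord P).
Proof.
rewrite /partial /derive /derive1; have [->|i1i] := eqVneq i i1.
  rewrite mul1r; congr (lim (_ @ 0^')); apply/funext => h /=.
  by rewrite !ycoordE !mxE/= mulr1.
rewrite mul0r.
rewrite [X in lim (X @ _)](_ : _ = cst 0); first exact: lim_cst.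
apply/funext => h /=.
by rewrite !ycoordE !mxE/= eq_sym (negbTE i1i) mulr0 add0r subrr scaler0.
Qed.

Lemma partial_ycoordZ (F : R -> R) (c : R) i P : (forall y : R, derivable F y 1) ->
  partial i (fun Q => c * F (ycoord Q)) P = (i == i1)%:R * (c * derive1 F (ycoord P)).
Proof. by move=> dF; rewrite (partial_ycoord (fun y => c * F y)) derive1Ml. Qed.

Definition Mf_inv f P : 'M[R]_4 := \matrix_(k < 4, l < 4)
  match nat_of_ord k, nat_of_ord l with
  | 2%N, 2%N => 2 * f (ycoord P)
  | 0%N, 2%N | 2%N, 0%N | 1%N, 3%N | 3%N, 1%N => 1
  | _, _ => 0
  end.

Lemma mulmx_Mf_inv f P : Mf f P *m Mf_inv f P = 1%:M.
Proof.
apply/matrixP => i j; rewrite !mxE big_ord4 !mxE.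
by elim/ord4_ind: i; elim/ord4_ind: j => /=; ring.
Qed.

Lemma invmx_Mf f P : invmx (Mf f P) = Mf_inv f P.
Proof.
have [u _] := mulmx1_unit (mulmx_Mf_inv f P).
by rewrite -[RHS]mul1mx -(mulVmx u) -mulmxA mulmx_Mf_inv mulmx1.
Qed.

Lemma partial_Mf f i j l P : (forall y : R, derivable f y 1) ->
  partial i (fun Q => Mf f Q j l) P =
  (i == i1)%:R * (j == i0)%:R * (l == i0)%:R * (- 2 * derive1 f (ycoord P)).
Proof.
move=> df.
pose F (y : R) : R := match nat_of_ord j, nat_of_ord l with
    | 0%N, 0%N => - 2 * f y
    | 0%N, 2%N | 2%N, 0%N | 1%N, 3%N | 3%N, 1%N => 1
    | _, _ => 0
    end.
rewrite (_ : (fun Q => _) = fun Q => F (ycoord Q)); last first.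
  by apply/funext => Q; rewrite mxE.
rewrite partial_ycoord -!mulrA; congr (_ * _).
rewrite /F; clear F; elim/ord4_ind: j; elim/ord4_ind: l => /=; rewrite ?mul1r ?mul0r ?mulr0 ?derive1_cst//.
by rewrite derive1Ml.
Qed.

(** The Levi-Civita connection with the factor f' removed: nabla_x d_x = f' d_y~ and nabla_x d_y =
    nabla_y d_x = - f' d_x~. *)
Definition christoffel_coef i j k : R :=
  (k == i3)%:R * (i == i0)%:R * (j == i0)%:R
  - (k == i2)%:R * ((i == i0)%:R * (j == i1)%:R + (i == i1)%:R * (j == i0)%:R).

Lemma christoffel_Mf f i j k P : (forall y : R, derivable f y 1) ->
  christoffel (Mf f) i j k P = christoffel_coef i j k * derive1 f (ycoord P).
Proof.
move=> df; rewrite /christoffel invmx_Mf big_ord4 !partial_Mf// !mxE.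
rewrite /christoffel_coef.
by elim/ord4_ind: k => /=; elim/ord4_ind: i => /=; elim/ord4_ind: j => /=; field.
Qed.

(** The upper index of a non-zero symbol is x~ or y~, while its lower indices are x or y. This
    removes the quadratic terms of the curvature. *)
Lemma christoffel_coef_mul i j k l m : christoffel_coef i j m * christoffel_coef k m l = 0.
Proof.
rewrite /christoffel_coef.
by elim/ord4_ind: m => /=; ring.
Qed.

Lemma curvature_Mf f i j k l P :
  (forall y : R, derivable f y 1) -> (forall y : R, derivable (derive1 f) y 1) ->
  curvature (Mf f) i j k l P =
  ((i == i1)%:R * christoffel_coef j k l - (j == i1)%:R * christoffel_coef i k l)
  * (derive1n 2 f) (ycoord P).
Proof.
move=> df d2f; rewrite /curvature.
rewrite big1 ?addr0; last first.
  move=> m _; rewrite !christoffel_Mf//.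
  by rewrite mulrACA christoffel_coef_mul mulrACA christoffel_coef_mul !mul0r subrr.
have ch i' j' k' : christoffel (Mf f) i' j' k' =
    fun Q => christoffel_coef i' j' k' * derive1 f (ycoord Q).
  by apply/funext => Q; rewrite christoffel_Mf.
rewrite !ch !partial_ycoordZ//.
by rewrite [RHS]mulrBl !mulrA.
Qed.

(** The components of the 2-form dx /\ dy; the curvature is - f'' times its tensor square. *)
Definition area_coef i j : R :=
  (i == i0)%:R * (j == i1)%:R - (i == i1)%:R * (j == i0)%:R.

(* The only component of the k-th covariant derivative of the curvature of
   [Mf f] that survives is R(x,y,y,x;y,...,y) = f^(k+2), up to the symmetries
   recorded by [area_coef]. *)
Fixpoint nabla_coef (k : nat) (s : seq 'I_4) : R :=
  match k, s with
  | 0%N, [:: a; b; c; d] => - (area_coef a b * area_coef c d)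
  | k'.+1, a :: s' => (a == i1)%:R * nabla_coef k' s'
  | _, _ => 0
  end.

Lemma riemann_Mf f (s : 4.-tuple 'I_4) P :
  (forall y : R, derivable f y 1) -> (forall y : R, derivable (derive1 f) y 1) ->
  riemann (Mf f) s P = nabla_coef 0 s * (derive1n 2 f) (ycoord P).
Proof.
move=> df d2f; rewrite /riemann.
case: s => [[|a [|b [|c [|d [|]]]]]] //= sz.
rewrite !(tnth_nth a) /= big_ord4 !curvature_Mf// !mxE.
rewrite /christoffel_coef /area_coef.
elim/ord4_ind: d => /=; elim/ord4_ind: c => /=; rewrite ?mulr0 ?mul0r ?addr0 ?subr0 ?subrr;
 by elim/ord4_ind: a => /=; elim/ord4_ind: b => /=; ring.
Qed.

Lemma nabla_coef0 (k : nat) (s : seq 'I_4) : has (fun i => 1 < i)%N s -> nabla_coef k s = 0.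
Proof.
have a0 i j : (1 < i)%N || (1 < j)%N -> area_coef i j = 0.
  by rewrite /area_coef; elim/ord4_ind: i => /=; elim/ord4_ind: j => //= _; ring.
elim: k s => [[|a [|b [|c [|d [|]]]]]//|k IH [|a s]//]/=.
  rewrite orbF !orbA -orbA => /orP[] /a0 ->; by rewrite ?mul0r ?mulr0 oppr0.
move=> /orP[|/IH ->]; last by rewrite mulr0.
by elim/ord4_ind: a => //= _; rewrite mul0r.
Qed.

(** The connection terms of [cov] vanish: a non-zero symbol puts x~ or y~ in a slot of a tensor that
    has no such component. Only the partial derivative remains, and it sees y alone. *)
Lemma nabla_riemann_Mf f (k : nat) (s : (4 + k).-tuple 'I_4) P :
  (forall n (y : R), derivable (derive1n n f) y 1) ->
  nabla_riemann (Mf f) k s P = nabla_coef k s * (derive1n k.+2 f) (ycoord P).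
Proof.
move=> df; elim: k s P => [|k IH] s P.
  by apply: riemann_Mf; [exact: (df 0%N)|exact: (df 1%N)].
rewrite [LHS]/= /cov.
rewrite [X in _ - X]big1 ?subr0; last first.
  move=> j _; apply: big1 => m _; rewrite IH (christoffel_Mf _ _ _ _ _ (df 0%N)).
  have [m1|m1] := leqP m 1.
    by rewrite /christoffel_coef; elim/ord4_ind: m m1 => //= _; rewrite !mul0r subrr !mul0r.
  rewrite nabla_coef0 ?mul0r ?mulr0//.
  apply/hasP; exists m => //; apply/tnthP; exists j.
  by rewrite tnth_mktuple eqxx.
rewrite (_ : nabla_riemann (Mf f) k _ = fun Q =>
   nabla_coef k (behead s) * (derive1n k.+2 f) (ycoord Q)); last first.
  by apply/funext => Q; rewrite IH.
rewrite partial_ycoordZ// mulrA; congr (_ * _).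
by rewrite [in RHS](tuple_eta s).
Qed.

(** A non-zero component has exactly two indices x and [k.+2] indices y. *)
Lemma nabla_coef_prod (k : nat) (s : seq 'I_4) (lam : 'I_4 -> R) :
  nabla_coef k s * \prod_(i <- s) lam i
  = nabla_coef k s * (lam i0 ^+ 2 * lam i1 ^+ k.+2).
Proof.
have a0 i j : area_coef i j * (lam i * lam j) = area_coef i j * (lam i0 * lam i1).
  rewrite /area_coef; elim/ord4_ind: i => /=; elim/ord4_ind: j => //=; ring.
elim: k s => [[|a [|b [|c [|d [|e s]]]]]|k IH [|a s]] /=; rewrite ?mul0r//.
  rewrite !big_cons big_nil mulr1.
  transitivity (- ((area_coef a b * (lam a * lam b)) * (area_coef c d * (lam c * lam d)))).
    by ring.
  by rewrite !a0; ring.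
rewrite big_cons mulrACA IH (exprS _ k.+2).
have [->|] := eqVneq a i1; last by rewrite !mul0r.
by ring.
Qed.

End MetricFamily.

(** * Pointwise models *)

Section Models.
Context {R : realType}.
Implicit Types (f h : R -> R) (P Q : 'rV[R]_4).

Lemma ip_Mf f P (u v : 'rV[R]_4) : ip (Mf f P) u v =
  - 2 * f (ycoord P) * u 0 i0 * v 0 i0 + u 0 i0 * v 0 i2 + u 0 i2 * v 0 i0
  + u 0 i1 * v 0 i3 + u 0 i3 * v 0 i1.
Proof. by rewrite /ip !mxE big_ord4 !mxE !big_ord4 !mxE /=; ring. Qed.

Lemma tensor_eval_multilinear n r (T : tensor R n r) (Q : 'rV[R]_n) :
  multilinear (tensor_eval T Q).
Proof.
move=> v j a x y; rewrite /tensor_eval mulr_sumr -big_split; apply: eq_bigr => s _ /=.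
have E z : \prod_(l < r) [eta v with j |-> z] l 0 (tnth s l) =
    z 0 (tnth s j) * \prod_(l < r | l != j) v l 0 (tnth s l).
  rewrite (bigD1 j)//= eqxx; congr (_ * _).
  by apply: eq_bigr => l /negbTE ->.
by rewrite !E !mxE; ring.
Qed.

Lemma is_model_Mf k f Q : is_model (model_of k (Mf f) Q).
Proof.
split=> /=.
- by move=> x y; rewrite !ip_Mf; ring.
- by move=> a x y z; rewrite !ip_Mf !mxE; ring.
- move=> x h0; apply/rowP => i; rewrite mxE.
  have x0 : x 0 i0 = 0 by have := h0 'e_i2; rewrite ip_Mf !mxE /=; lra.
  have x1 : x 0 i1 = 0 by have := h0 'e_i3; rewrite ip_Mf !mxE /=; lra.
  have x2 : x 0 i2 = 0 by have := h0 'e_i0; rewrite ip_Mf !mxE /= x0; lra.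
  have x3 : x 0 i3 = 0 by have := h0 'e_i1; rewrite ip_Mf !mxE /=; lra.
  by elim/ord4_ind: i.
- by move=> i; exact: tensor_eval_multilinear.
Qed.

Definition frame_change (a b d : R) : 'M[R]_4 := \matrix_(i < 4, j < 4)
  match nat_of_ord i, nat_of_ord j with
  | 0%N, 0%N => a | 0%N, 2%N => b | 1%N, 1%N => d
  | 2%N, 2%N => a^-1 | 3%N, 3%N => d^-1 | _, _ => 0
  end.

Lemma frame_change_bij (a b d : R) : a != 0 -> d != 0 ->
  bijective (mulmxr (frame_change a b d) : 'rV[R]_4 -> 'rV[R]_4).
Proof.
move=> a0 d0; exists (mulmxr (frame_change a^-1 (- b) d^-1)) => v /=;
  rewrite -mulmxA -[RHS]mulmx1; congr (_ *m _); apply/matrixP => i j;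
  rewrite !mxE big_ord4 !mxE; elim/ord4_ind: i; elim/ord4_ind: j => /=; field;
  by rewrite ?a0 ?d0.
Qed.

Lemma tensor_eval_frame_change (a b d : R) k f h P Q (v : 'I_(4 + k) -> 'rV[R]_4) :
  (forall n (y : R), derivable (derive1n n f) y 1) ->
  (forall n (y : R), derivable (derive1n n h) y 1) ->
  a ^+ 2 * d ^+ k.+2 * derive1n k.+2 h (ycoord Q) = derive1n k.+2 f (ycoord P) ->
  tensor_eval (nabla_riemann (Mf h) k) Q (mulmxr (frame_change a b d) \o v) =
  tensor_eval (nabla_riemann (Mf f) k) P v.
Proof.
move=> df dh E; apply: eq_bigr => s _; rewrite !nabla_riemann_Mf// -E.
have [s1|s1] := boolP (has (fun i : 'I_4 => 1 < i)%N s).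
  by rewrite (nabla_coef0 _ _ s1) !mul0r.
(* On the x and y coordinates the frame change is diagonal with entries [a] and [d]; components with
   an index x~ or y~ have just been discarded. *)
pose lam (i : 'I_4) := if i == i0 then a else d.
have -> : \prod_(j < 4 + k) (mulmxr (frame_change a b d) \o v) j 0 (tnth s j) =
    (\prod_(i <- s) lam i) * \prod_(j < 4 + k) v j 0 (tnth s j).
  rewrite big_tuple -big_split; apply: eq_bigr => j _ /=.
  have : ~~ (1 < tnth s j)%N.
    by apply: contra s1 => s1; apply/hasP; exists (tnth s j) => //; exact: mem_tnth.
  rewrite !mxE big_ord4 !mxE /lam.
  by elim/ord4_ind: (tnth s j) => //= _; ring.
move: (derive1n k.+2 h _) (\prod_(_ < _) _) => x y.
by rewrite mulrACA nabla_coef_prod /lam eqxx /=; ring.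
Qed.

Lemma is_model_for_Mf k f h Q :
  (forall n (y : R), derivable (derive1n n f) y 1) ->
  (forall n (y : R), derivable (derive1n n h) y 1) ->
  (forall y : R, exists a d : R, [/\ a != 0, d != 0 & forall i, (i <= k)%N ->
    a ^+ 2 * d ^+ i.+2 * derive1n i.+2 h (ycoord Q) = derive1n i.+2 f y]) ->
  is_model_for (model_of k (Mf h) Q) (Mf f).
Proof.
move=> df dh H; split; first exact: is_model_Mf.
move=> P; have [a [d [a0 d0 E]]] := H (ycoord P).
(* The product of d_x with itself forces - 2 a^2 h + 2 a b = - 2 f; the remaining products hold for
   every [b]. *)
pose b := h (ycoord Q) * a - f (ycoord P) / a.
exists (mulmxr (frame_change a b d)); split.
- exact: frame_change_bij.
- move=> u v /=; rewrite !ip_Mf !mxE !big_ord4 !mxE /= /b; field.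
  by rewrite a0 d0.
- move=> i v; apply: tensor_eval_frame_change => //.
  by apply: E; rewrite -ltnS.
Qed.

Lemma derive1n_horner (p : {poly R}) n : derive1n n (horner p) = horner (derivn n p).
Proof. by elim: n => // n IH; rewrite derive1nS IH -derivE derivnS. Qed.

Lemma sqr_horner : (fun y : R => y ^+ 2) = horner ('X^2).
Proof. by apply/funext => y; rewrite hornerXn. Qed.

Lemma derivable_sqr n (y : R) : derivable (derive1n n (fun y : R => y ^+ 2)) y 1.
Proof. by rewrite sqr_horner derive1n_horner; exact: derivable_horner. Qed.

Lemma derive1n_sqr n : derive1n n (fun y : R => y ^+ 2) =
  fun y => y ^+ (2 - n) *+ (2 ^_ n).
Proof.
by rewrite sqr_horner derive1n_horner derivnXn; apply/funext => y; rewrite hornerMn hornerXn.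
Qed.

Lemma derive1n_expR n : derive1n n (@expR R) = expR.
Proof. by elim: n => // n IH; rewrite derive1nS IH; apply/funext => y; rewrite derive1E derive_val. Qed.

Lemma derivable_expRn n (y : R) : derivable (derive1n n (@expR R)) y 1.
Proof. by rewrite derive1n_expR; exact: derivable_expR. Qed.

(* [a] and [d] are the ratios by which a model isomorphism rescales d_x and
   d_y; it multiplies R by a^2 d^2 and nabla R by a^2 d^3. *)
Lemma frame_scaling (A B : R) : 0 < A -> 0 < B ->
  exists a d, [/\ a != 0, d != 0, a ^+ 2 * d ^+ 2 = A & a ^+ 2 * d ^+ 3 = B].
Proof.
move=> A0 B0; exists (Num.sqrt A / (B / A)), (B / A).
have d0 : B / A != 0 by rewrite gt_eqF// divr_gt0.
split=> //.
- by rewrite mulf_neq0 ?invr_neq0// gt_eqF// sqrtr_gt0.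
- by rewrite -exprMn divfK// sqr_sqrtr// ltW.
- rewrite (exprSr _ 2) mulrA -exprMn divfK// sqr_sqrtr ?ltW//.
  by rewrite mulrC divfK// gt_eqF.
Qed.

Lemma C2_model f : C2 f -> is_model_for (model_of 0 (Mf (fun y : R => y ^+ 2)) 0) (Mf f).
Proof.
move=> [fa f2]; apply: is_model_for_Mf.
- by move=> n y; apply: real_analytic_derivable; exact: real_analytic_derive1n.
- exact: derivable_sqr.
- move=> y; have A0 : 0 < derive1n 2 f y / 2 by apply: divr_gt0 => //; exact: f2.
  (* A 0-model constrains only a^2 d^2, so the prescribed value 1 of a^2 d^3 is arbitrary. *)
  have [a [d [a0 d0 A _]]] := frame_scaling _ _ A0 ltr01.
  exists a, d; split; [exact: a0|exact: d0|move=> [|//] _].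
  rewrite derive1n_sqr subnn expr0 A.
  exact: divfK.
Qed.

Lemma C3_model f : C3 f -> is_model_for (model_of 1 (Mf (@expR R)) 0) (Mf f).
Proof.
move=> [fa f2 f3]; apply: is_model_for_Mf.
- by move=> n y; apply: real_analytic_derivable; exact: real_analytic_derive1n.
- exact: derivable_expRn.
(* At the origin all derivatives of the exponential are 1, so the values to be reached are f'' and
   f''' themselves. *)
- move=> y; have [a [d [a0 d0 A B]]] := frame_scaling _ _ (f2 y) (f3 y).
  exists a, d; split; [exact: a0|exact: d0|move=> i i1].
  rewrite derive1n_expR /ycoord mxE expR0 mulr1.
  case: i i1 => [|[|i]] i1.
  - rewrite A; reflexivity.
  - rewrite B; reflexivity.
  - discriminate i1.
Qed.

End Models.

(** * Polynomial isometries *)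

Section PolynomialMaps.
Context {R : realType} {n : nat}.
Implicit Types (P Q : 'rV[R]_n) (i j : 'I_n).

(* Reified polynomials, so that iterated partial derivatives compute. *)
Inductive pterm := Pcst of R | Pvar of 'I_n | Padd of pterm & pterm | Pmul of pterm & pterm.

Fixpoint peval (t : pterm) P : R :=
  match t with
  | Pcst c => c
  | Pvar i => P 0 i
  | Padd t1 t2 => peval t1 P + peval t2 P
  | Pmul t1 t2 => peval t1 P * peval t2 P
  end.

Fixpoint pder i (t : pterm) : pterm :=
  match t with
  | Pcst c => Pcst 0
  | Pvar j => Pcst (i == j)%:R
  | Padd t1 t2 => Padd (pder i t1) (pder i t2)
  | Pmul t1 t2 => Padd (Pmul t1 (pder i t2)) (Pmul t2 (pder i t1))
  end.

Lemma differentiable_peval t P : differentiable (peval t) P.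
Proof.
elim: t => [c|i|t1 h1 t2 h2|t1 h1 t2 h2].
- exact: differentiable_cst.
- exact: differentiable_coord.
- exact: differentiableD.
- exact: differentiableM.
Qed.

Lemma partial_coord i k P : partial i (fun Q : 'rV[R]_n => Q 0 k) P = (i == k)%:R.
Proof.
rewrite /partial /derive.
apply/cvg_lim => //; apply: cvg_near_cst; near=> h.
rewrite /= !mxE/= addrK eq_sym [_ *: _]mulrA mulVf ?mul1r//.
by near: h; exact: nbhs_dnbhs_neq.
Unshelve. all: by end_near. Qed.

Lemma partial_peval i t : partial i (peval t) = peval (pder i t).
Proof.
apply/funext => P; rewrite /partial; elim: t => [c|k|t1 h1 t2 h2|t1 h1 t2 h2] /=.
- exact: derive_cst.
- exact: partial_coord.
- by rewrite -h1 -h2; apply: deriveD; apply: diff_derivable; exact: differentiable_peval.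
- by rewrite -h1 -h2; apply: deriveM; apply: diff_derivable; exact: differentiable_peval.
Qed.

Lemma differentiable_row m (p : 'I_m -> 'rV[R]_n -> R) P :
  (forall k, differentiable (p k) P) -> differentiable (fun Q => \row_k p k Q) P.
Proof.
move=> dp; rewrite (_ : (fun Q => _) = \sum_(k < m) (fun Q => p k Q *: 'e_k)); last first.
  apply/funext => Q; rewrite fct_sumE [LHS]row_sum_delta.
  by apply: eq_bigr => k _; rewrite mxE.
by apply: differentiable_sum => k; exact: differentiableZl.
Qed.

Lemma partial_row m (p : 'I_m -> 'rV[R]_n -> R) i P :
  (forall k, differentiable (p k) P) ->
  partial i (fun Q => \row_k p k Q) P = \row_k partial i (p k) P.
Proof.
move=> dp; rewrite /partial derive_mx; last first.
  by apply: diff_derivable; exact: differentiable_row.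
apply/rowP => k; rewrite !mxE.
have -> : (fun Q => (\row_l p l Q) 0 k) = p k by apply/funext => Q; rewrite mxE.
by [].
Qed.

Lemma smooth_peval m (t : 'I_m -> pterm) : smooth (fun Q => \row_k peval (t k) Q).
Proof.
move=> s P.
suff -> : foldr (@partial R n _) (fun Q => \row_k peval (t k) Q) s =
    fun Q => \row_k peval (foldr pder (t k) s) Q.
  by apply: differentiable_row => k; exact: differentiable_peval.
elim: s => //= i s ->; apply/funext => Q; rewrite partial_row.
  by apply/rowP => k; rewrite !mxE partial_peval.
by move=> k; exact: differentiable_peval.
Qed.

Lemma diff_partial (W : normedModType R) (F : 'rV[R]_n -> W) P (u : 'rV[R]_n) :
  differentiable F P -> 'd F P u = \sum_(i < n) u 0 i *: partial i F P.
Proof.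
move=> dF; rewrite [in LHS](row_sum_delta u) linear_sum; apply: eq_bigr => i _.
by rewrite linearZ /partial deriveE.
Qed.

End PolynomialMaps.

(** * Isometries covering affine changes of y, and homogeneity of the two models *)

Section AffineIsometries.
Context {R : realType}.
Implicit Types (f : R -> R) (P Q : 'rV[R]_4).

(* The map x -> a x, y -> d y + e, with x~ and y~ corrected so that the terms
   b y + c of f1 (y) = a^2 f2 (d y + e) + b y + c are absorbed:
   - 2 (b y + c) dx^2 = 2 dx d(- c x - b x y) + 2 dy d(b x^2 / 2). *)
Definition iso_term (a d e b c x0 z0 w0 : R) (k : 'I_4) : @pterm R 4 :=
  match nat_of_ord k with
  | 0%N => Padd (Pmul (Pcst a) (Pvar i0)) (Pcst x0)
  | 1%N => Padd (Pmul (Pcst d) (Pvar i1)) (Pcst e)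
  | 2%N => Padd (Pmul (Pcst a^-1) (Padd (Pvar i2)
             (Pmul (Pvar i0) (Padd (Pmul (Pcst (- b)) (Pvar i1)) (Pcst (- c)))))) (Pcst z0)
  | _ => Padd (Pmul (Pcst d^-1) (Padd (Pvar i3)
             (Pmul (Pcst (b / 2)) (Pmul (Pvar i0) (Pvar i0))))) (Pcst w0)
  end.

Definition iso_inv_term (a d e b c x0 z0 w0 : R) (k : 'I_4) : @pterm R 4 :=
  let x := Pmul (Pcst a^-1) (Padd (Pvar i0) (Pcst (- x0))) in
  let y := Pmul (Pcst d^-1) (Padd (Pvar i1) (Pcst (- e))) in
  match nat_of_ord k with
  | 0%N => x
  | 1%N => y
  | 2%N => Padd (Pmul (Pcst a) (Padd (Pvar i2) (Pcst (- z0))))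
             (Pmul x (Padd (Pmul (Pcst b) y) (Pcst c)))
  | _ => Padd (Pmul (Pcst d) (Padd (Pvar i3) (Pcst (- w0))))
             (Pmul (Pcst (- b / 2)) (Pmul x x))
  end.

Lemma affine_isometry f1 f2 (a d e b c x0 z0 w0 : R) : a != 0 -> d != 0 ->
  (forall y, f1 y = a ^+ 2 * f2 (d * y + e) + b * y + c) ->
  metric_isometry (Mf f1) (Mf f2)
    (fun P => \row_k peval (iso_term a d e b c x0 z0 w0 k) P).
Proof.
move=> a0 d0 E; split; first exact: smooth_peval.
- exists (fun P => \row_k peval (iso_inv_term a d e b c x0 z0 w0 k) P); split.
  + exact: smooth_peval.
  + move=> P; apply/rowP; elim/ord4_ind; rewrite !mxE /= !mxE /=; field; by rewrite ?a0 ?d0.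
  + move=> P; apply/rowP; elim/ord4_ind; rewrite !mxE /= !mxE /=; field; by rewrite ?a0 ?d0.
- move=> P u v.
  have D w k : ('d (fun P => \row_k peval (iso_term a d e b c x0 z0 w0 k) P) P w) 0 k =
      \sum_(i < 4) w 0 i * peval (pder i (iso_term a d e b c x0 z0 w0 k)) P.
    rewrite diff_partial; last by apply: differentiable_row => l; exact: differentiable_peval.
    rewrite summxE; apply: eq_bigr => i _.
    rewrite partial_row ?mxE ?partial_peval// => l; exact: differentiable_peval.
  rewrite !ip_Mf !D !big_ord4 !ycoordE !mxE /= E; field.
  by rewrite a0 d0.
Qed.

Lemma affine_isometry_ex f1 f2 (a d e b c : R) P1 P2 : a != 0 -> d != 0 ->
  (forall y, f1 y = a ^+ 2 * f2 (d * y + e) + b * y + c) ->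
  ycoord P2 = d * ycoord P1 + e ->
  exists2 phi, metric_isometry (Mf f1) (Mf f2) phi & phi P1 = P2.
Proof.
move=> a0 d0 E P12.
pose t := iso_term a d e b c 0 0 0.
(* The translations in x, x~ and y~ are free and make up the missing displacement; the y-coordinate
   is right by assumption. *)
pose s k := P2 0 k - peval (t k) P1.
exists (fun P => \row_k peval (iso_term a d e b c (s i0) (s i2) (s i3) k) P).
  exact: affine_isometry.
move: P12; rewrite !ycoordE => P12.
by apply/rowP; elim/ord4_ind; rewrite mxE /s /t /= ?P12; ring.
Qed.

Lemma homogeneous_sqr : homogeneous (Mf (fun y : R => y ^+ 2)).
Proof.
move=> P Q; pose e := ycoord Q - ycoord P.
(* From y^2 = (y + e)^2 - 2 e y - e^2. *)
apply: (@affine_isometry_ex _ _ 1 1 e (- 2 * e) (- e ^+ 2)); rewrite ?oner_neq0//.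
  by move=> y; ring.
by rewrite /e; ring.
Qed.

Lemma homogeneous_expR : homogeneous (Mf (@expR R)).
Proof.
move=> P Q; pose e := ycoord Q - ycoord P.
(* From exp(y) = exp(- e / 2)^2 exp(y + e). *)
apply: (@affine_isometry_ex _ _ (expR (- e / 2)) 1 e 0 0); rewrite ?oner_neq0//.
- by rewrite gt_eqF// expR_gt0.
- move=> y; rewrite -expRM_natl -expRD mul0r !addr0; congr expR.
  by rewrite mul1r; field.
by rewrite /e; ring.
Qed.

End AffineIsometries.

(** * The symmetric space of the square function *)

Section SquareModel.
Context {R : realType}.
Implicit Types (P Q v w : 'rV[R]_4).

Local Notation Msqr := (Mf (fun y : R => y ^+ 2)).

(** When f' (y) = 2 y, geodesics are polynomial, and so are parallel fields along polynomial curves;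
    explicit polynomials therefore suffice for completeness and holonomy. *)
Definition pcurve (p : 'I_4 -> {poly R}) (t : R) : 'rV[R]_4 := \row_k (p k).[t].

Lemma derivable_pcurve p t : derivable (pcurve p) t 1.
Proof.
apply/derivable_mxP => i j.
rewrite (_ : (fun x => pcurve p x i j) = horner (p j)); first exact: derivable_horner.
by apply/funext => x; rewrite mxE.
Qed.

Lemma derive1_pcurve p : derive1 (pcurve p) = pcurve (fun k => deriv (p k)).
Proof.
apply/funext => t; rewrite derive1E derive_mx; last exact: derivable_pcurve.
apply/matrixP => i j; rewrite !mxE.
rewrite (_ : (fun x => pcurve p x i j) = horner (p j)); last first.
  by apply/funext => x; rewrite mxE.
by rewrite -derive1E -derivE.
Qed.

Lemma smooth_pcurve p : smooth_curve (pcurve p).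
Proof.
move=> k t; suff [q ->] : exists q, derive1n k (pcurve p) = pcurve q.
  exact: derivable_pcurve.
elim: k => [|k [q IH]]; first by exists p.
by exists (fun k => deriv (q k)); rewrite derive1nS IH derive1_pcurve.
Qed.

Lemma derive1_sqr (y : R) : derive1 (fun y : R => y ^+ 2) y = 2 * y.
Proof. by rewrite -derive1n1 derive1n_sqr ffactn1 subSS subn0 expr1 mulr_natl. Qed.

Lemma parallel_pcurve (c X : 'I_4 -> {poly R}) :
  (forall t, (deriv (X i0)).[t] = 0) -> (forall t, (deriv (X i1)).[t] = 0) ->
  (forall t, (deriv (X i2)).[t] =
    2 * (c i1).[t] * ((deriv (c i0)).[t] * (X i1).[t] + (deriv (c i1)).[t] * (X i0).[t])) ->
  (forall t, (deriv (X i3)).[t] = - 2 * (c i1).[t] * ((deriv (c i0)).[t] * (X i0).[t])) ->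
  parallel_along Msqr (pcurve c) (pcurve X).
Proof.
move=> h0 h1 h2 h3 t; split; first exact: derivable_pcurve.
move=> k; rewrite !derive1_pcurve !big_ord4.
rewrite !(christoffel_Mf _ _ _ _ _ (derivable_sqr 0)) derive1_sqr ycoordE !mxE.
rewrite /christoffel_coef.
elim/ord4_ind: k => /=; rewrite ?h0 ?h1 ?h2 ?h3; ring.
Qed.

Lemma geodesically_complete_sqr : geodesically_complete Msqr.
Proof.
(* x and y are affine in t; then x~'' = 4 y x' y' and y~'' = - 2 y x'^2 are integrated twice, which
   gives cubics. *)
move=> P v; pose p (k : 'I_4) : {poly R} := match nat_of_ord k with
  | 0%N => (P 0 i0)%:P + (v 0 i0) *: 'X
  | 1%N => (P 0 i1)%:P + (v 0 i1) *: 'X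
  | 2%N => (P 0 i2)%:P + (v 0 i2) *: 'X
           + (v 0 i0 * v 0 i1) *: ((2 * P 0 i1) *: 'X^2 + (2 / 3 * v 0 i1) *: 'X^3)
  | _ => (P 0 i3)%:P + (v 0 i3) *: 'X
           - (v 0 i0 ^+ 2) *: ((P 0 i1) *: 'X^2 + (v 0 i1 / 3) *: 'X^3)
  end.
have pE : pcurve p 0 = P.
  by apply/rowP; elim/ord4_ind; rewrite mxE /= !hornerE /= ?expr0n /=; ring.
have dpE : derive1 (pcurve p) 0 = v.
  by rewrite derive1_pcurve; apply/rowP; elim/ord4_ind;
    rewrite mxE /= !poly.derivE !hornerE /= ?expr0n /=; ring.
exists (pcurve p); split=> //; split; first exact: derivable_pcurve.
rewrite derive1_pcurve; by apply: parallel_pcurve => t /=; rewrite !poly.derivE !hornerE /=; field.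
Qed.

Lemma symmetric_space_sqr : symmetric_space Msqr.
Proof.
split; first exact: geodesically_complete_sqr.
move=> s P; rewrite (nabla_riemann_Mf _ _ _ _ derivable_sqr) derive1n_sqr.
by rewrite ffact_small// mulr0n mulr0.
Qed.

(* Transport along a loop c adds I v_y to the x~-component and - I v_x to the
   y~-component of v, where I is the integral of 2 y dx along c; the loop of
   [holonomy_sqr] has I = - 1/30. *)
Definition loop_holonomy : 'M[R]_4 := \matrix_(i < 4, j < 4)
  match nat_of_ord i, nat_of_ord j with
  | 1%N, 2%N => - 30^-1
  | 0%N, 3%N => 30^-1
  | _, _ => (i == j)%:R
  end.

Lemma loop_holonomyE v (k : 'I_4) : (v *m loop_holonomy) 0 k =
  match nat_of_ord k with
  | 2%N => v 0 i2 - v 0 i1 / 30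
  | 3%N => v 0 i3 + v 0 i0 / 30
  | _ => v 0 k
  end.
Proof. by rewrite !mxE big_ord4 !mxE; elim/ord4_ind: k => /=; ring. Qed.

Lemma holonomy_sqr P : holonomy Msqr P loop_holonomy.
Proof.
(* The loop closes up because t - t^2 and t^2 - t^3 both vanish at 0 and at 1. *)
pose c (k : 'I_4) : {poly R} := match nat_of_ord k with
  | 0%N => (P 0 i0)%:P + 'X - 'X^2
  | 1%N => (P 0 i1)%:P + 'X^2 - 'X^3
  | _ => (P 0 k)%:P
  end.
have c0 : pcurve c 0 = P.
  by apply/rowP; elim/ord4_ind; rewrite mxE /= !hornerE /= ?expr0n /= ?subr0 ?addr0.
have c1 : pcurve c 1 = P.
  by apply/rowP; elim/ord4_ind; rewrite mxE /= !hornerE /= ?expr1n ?addrK.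
rewrite /holonomy -[X in parallel_transport _ X _]c0 -[X in parallel_transport _ _ X]c1.
apply: Transport_smooth; first exact: smooth_pcurve.
(* [q] is the integral of 2 y dx along the loop from time 0 to t, and q(1) = 2/3 - 3/2 + 4/5 = -
   1/30. The square of [c i1] below integrates 2 y dy and contributes nothing at t = 1. *)
move=> v; pose q : {poly R} := (2 * P 0 i1) *: ('X - 'X^2) + (2 / 3) *: 'X^3
  - (3 / 2) *: 'X^4 + (4 / 5) *: 'X^5.
pose X (k : 'I_4) : {poly R} := match nat_of_ord k with
  | 2%N => (v 0 i2)%:P + v 0 i1 *: q + v 0 i0 *: (c i1 ^+ 2)
           - (v 0 i0 * P 0 i1 ^+ 2)%:P
  | 3%N => (v 0 i3)%:P - v 0 i0 *: q
  | _ => (v 0 k)%:P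
  end.
exists (pcurve X); split.
- by apply: parallel_pcurve => t; rewrite /= /q !poly.derivE !hornerE /=; field.
- by apply/rowP; elim/ord4_ind; rewrite mxE /= /q !hornerE /= ?expr0n /=; ring.
- by apply/rowP; elim/ord4_ind; rewrite mxE loop_holonomyE /= /q !hornerE /= ?expr1n /=; field.
Qed.

(** The plane spanned by d_x~ and d_y~ is totally isotropic, so a non-degenerate [W] inside it is
    zero. Otherwise [W] contains [w] outside the plane, and non-degeneracy paired with [N w]
    provides [u] in [W] independent of [w] modulo the plane; then [w], [u], [N w] and [N u] form a
    basis. *)
Lemma irreducible_sqr : irreducible Msqr.
Proof.
move=> P W nd hol.
have [h|h] := pselect (forall w, w \in W -> w 0 i0 = 0 /\ w 0 i1 = 0).
  left; apply/eqP; rewrite -vpick0; apply/eqP/nd; first exact: memv_pick.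
  move=> u /h[u0 u1]; have [w0 w1] := h _ (memv_pick W).
  by rewrite ip_Mf u0 u1 w0 w1; ring.
right.
pose N w : 'rV[R]_4 := - 30 *: (w *m loop_holonomy - w).
have NW w : w \in W -> N w \in W.
  by move=> wW; rewrite memvZ// memvB//; apply: hol wW; exact: holonomy_sqr.
have NE w (k : 'I_4) : N w 0 k =
    match nat_of_ord k with 2%N => w 0 i1 | 3%N => - w 0 i0 | _ => 0 end.
  by rewrite mxE mxE loop_holonomyE mxE; elim/ord4_ind: k => /=; field.
have [w [wW w01]] : exists w, w \in W /\ (w 0 i0 <> 0 \/ w 0 i1 <> 0).
  apply: contrapT => H; apply: h => w wW; split; apply: contrapT => H'; apply: H.
    by exists w; split=> //; left.
  by exists w; split=> //; right.
have [u [uW]] : exists u, u \in W /\ ip (Msqr P) (N w) u <> 0.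
  apply: contrapT => H.
  have /(nd _ (NW _ wW)) Nw0 : forall u, u \in W -> ip (Msqr P) (N w) u = 0.
    by move=> u uW; apply: contrapT => H'; apply: H; exists u.
  have := NE w i2; have := NE w i3; rewrite Nw0 !mxE /= => e1 e2.
  by case: w01; apply; [apply/eqP; rewrite -oppr_eq0 -e1|rewrite -e2].
rewrite ip_Mf !NE /= => /eqP d0.
(* The pairing of [N w] with [u] is the determinant of the x and y coordinates of [w] and [u].
   Cramer's rule with denominator [d] gives all four coefficients below. *)
pose d := w 0 i1 * u 0 i0 - w 0 i0 * u 0 i1.
have {}d0 : d != 0 by move: d0; rewrite !mulr0 !mul0r !addr0 !add0r mulNr.
apply/vspaceP => z; rewrite memvf.
pose a := (z 0 i1 * u 0 i0 - z 0 i0 * u 0 i1) / d.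
pose b := (w 0 i1 * z 0 i0 - w 0 i0 * z 0 i1) / d.
pose r := z - a *: w - b *: u.
have -> : z = a *: w + b *: u + ((r 0 i2 * u 0 i0 + r 0 i3 * u 0 i1) / d) *: N w
    - ((r 0 i2 * w 0 i0 + r 0 i3 * w 0 i1) / d) *: N u.
  rewrite /r; move: (N w) (N u) (NE w) (NE u) => Nw Nu Ew Eu.
  by apply/rowP; elim/ord4_ind; rewrite !mxE Ew Eu /= /a /b /d; field; exact: d0.
by apply: memvB; [apply: memvD; [apply: memvD|]|]; apply: memvZ => //; exact: NW.
Qed.

End SquareModel.

(** * Smooth functions of several variables *)

Section SecondDerivatives.
Context {R : realType} {n : nat}.
Implicit Types (F : 'rV[R]_n -> R) (P Q u : 'rV[R]_n) (i j : 'I_n).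

Lemma is_derive_line F Q u (t : R) : derivable F (Q + t *: u) u ->
  is_derive t 1 (fun t : R => F (Q + t *: u)) ('D_u F (Q + t *: u)).
Proof.
move=> dF.
have E : (fun h : R => h^-1 *: (((fun t : R => F (Q + t *: u)) \o shift t) (h *: 1) - F (Q + t *: u)))
    = (fun h => h^-1 *: ((F \o shift (Q + t *: u)) (h *: u) - F (Q + t *: u))).
  apply/funext => h /=; congr (_ *: (F _ - _)).
  by rewrite [_%:A]mulr1 scalerDl addrCA.
by apply: DeriveDef; rewrite /derivable /derive E.
Qed.

Lemma MVT_line F Q u (s : R) : 0 < s -> (forall P, differentiable F P) ->
  exists2 t, 0 <= t <= s & F (Q + s *: u) - F Q = s * 'D_u F (Q + t *: u).
Proof.
move=> s0 dF.
have d (t : R) : is_derive t 1 (fun t : R => F (Q + t *: u)) ('D_u F (Q + t *: u)).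
  by apply: is_derive_line; exact: diff_derivable.
have [|t t0s] := @MVT_segment R (fun t => F (Q + t *: u)) (fun t => 'D_u F (Q + t *: u)) 0 s (ltW s0) (fun t _ => d t).
  apply: continuous_subspaceT => t; apply: differentiable_continuous.
  by apply/derivable1_diffP; have [] := d t.
rewrite scale0r addr0 subr0 mulrC => E.
by exists t => //; move: t0s; rewrite in_itv.
Qed.

(** The mean value theorem is applied twice: along [i] to the increment of F in direction [j], then
    along [j] to the partial derivative of F in direction [i]. *)
Lemma second_difference F P i j (s : R) : 0 < s ->
  (forall P, differentiable F P) -> (forall P, differentiable (partial i F) P) ->
  exists t r : R, [/\ 0 <= t <= s, 0 <= r <= s &
    F (P + s *: 'e_i + s *: 'e_j) - F (P + s *: 'e_i) - F (P + s *: 'e_j) + F P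
    = s ^+ 2 * partial j (partial i F) (P + t *: 'e_i + r *: 'e_j)].
Proof.
move=> s0 dF diF.
pose G := (fun Q => F (Q + s *: 'e_j)) - F.
have dsh Q : differentiable (fun Q => F (Q + s *: 'e_j)) Q.
  apply: (@differentiable_comp _ _ _ _ (fun Q => Q + s *: 'e_j) F) => //.
have dG Q : differentiable G Q by apply: differentiableB.
have [t t0s E] := MVT_line G P 'e_i s s0 dG.
have [r r0s E2] := MVT_line (partial i F) (P + t *: 'e_i) 'e_j s s0 diF.
exists t, r; split=> //.
have shift_derive Q : 'D_'e_i (fun Q => F (Q + s *: 'e_j)) Q = partial i F (Q + s *: 'e_j).
  rewrite /partial /derive; congr (lim (_ @ 0^')); apply/funext => h /=.
  by rewrite addrA.
move: E; rewrite {2}/G deriveB; [|exact: diff_derivable|exact: diff_derivable].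
rewrite shift_derive -/(partial i F _) E2 mulrA -expr2 => <-.
rewrite /G /=.
have -> : ((fun Q => F (Q + s *: 'e_j)) - F) (P + s *: 'e_i) =
  F (P + s *: 'e_i + s *: 'e_j) - F (P + s *: 'e_i) by [].
have -> : ((fun Q => F (Q + s *: 'e_j)) - F) P = F (P + s *: 'e_j) - F P by [].
by ring.
Qed.

Lemma normr_delta i : `|'e_i : 'rV[R]_n| <= 1.
Proof.
rewrite [leLHS]/Num.Def.normr/= mx_normrE; apply: bigmax_le => // k _.
by rewrite mxE normr_nat lern1 leq_b1.
Qed.

(** The second difference is symmetric in [i] and [j], so the two mixed derivatives take a common
    value at two points close to [P]; both are continuous at [P]. *)
Lemma partialC F i j P : smooth F -> partial i (partial j F) P = partial j (partial i F) P.
Proof.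
move=> sF; apply/eqP; rewrite -subr_eq0 -normr_le0; apply/ler_addgt0Pl => e e0.
rewrite addr0.
pose A := partial i (partial j F); pose B := partial j (partial i F).
have nearP (G : 'rV[R]_n -> R) : differentiable G P -> \forall Q \near P, `|G P - G Q| < e / 2.
  by move=> /differentiable_continuous/cvgrPdist_lt; apply; exact: divr_gt0.
have close (x y z : R) : `|x - y| < e / 2 -> `|z - y| < e / 2 -> `|x - z| <= e.
  by move=> h1; rewrite (distrC z) => h2; have := ler_distD y x z; lra.
have /nbhs_ballP[r /= r0 H] : \forall Q \near P, `|A P - A Q| < e / 2 /\ `|B P - B Q| < e / 2.
  have ci := nearP _ (sF [:: i; j] P).
  have cj := nearP _ (sF [:: j; i] P).
  exact: filterI ci cj.
(* Two moves of length at most [s] stay strictly inside the ball of radius [r]. *)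
pose s := r / 3.
have s0 : 0 < s by rewrite divr_gt0.
have inball t t' k l : 0 <= t <= s -> 0 <= t' <= s -> ball P r (P + t *: 'e_k + t' *: 'e_l).
  move=> /andP[t0 ts] /andP[t0' ts'].
  rewrite -ball_normE /= opprD addrA opprD addrA subrr sub0r.
  rewrite (le_lt_trans (ler_normB _ _))// normrN !normrZ !ger0_norm//.
  have h1 := normr_delta k; have h2 := normr_delta l.
  have : t * `|'e_k : 'rV[R]_n| <= t by rewrite ler_piMr.
  have : t' * `|'e_l : 'rV[R]_n| <= t' by rewrite ler_piMr.
  move: ts ts'; rewrite /s; lra.
have [t [t' [t0 t0' E]]] := second_difference F P i j s s0 (sF [::]) (sF [:: i]).
have [q [q' [q0 q0' E']]] := second_difference F P j i s s0 (sF [::]) (sF [:: j]).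
have EE : partial j (partial i F) (P + t *: 'e_i + t' *: 'e_j) =
     partial i (partial j F) (P + q *: 'e_j + q' *: 'e_i).
  apply: (@mulfI _ (s ^+ 2)); first by rewrite expf_neq0// gt_eqF.
  apply: (etrans (esym E)); apply: etrans E'.
  rewrite [P + s *: 'e_j + _]addrAC; congr (_ + _); exact: addrAC.
have [_ hB] := H _ (inball _ _ i j t0 t0').
have [hA _] := H _ (inball _ _ j i q0 q0').
apply: close hA _; have <- : B (P + t *: 'e_i + t' *: 'e_j) = A (P + q *: 'e_j + q' *: 'e_i) by exact: EE.
exact: hB.
Qed.

Lemma smooth_partial (W : normedModType R) (F : 'rV[R]_n -> W) i : smooth F -> smooth (partial i F).
Proof. by move=> sF s P; have := sF (rcons s i) P; rewrite foldr_rcons. Qed.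

Lemma partial_comp (f : R -> R) F i P : derivable f (F P) 1 -> differentiable F P ->
  partial i (fun Q => f (F Q)) P = derive1 f (F P) * partial i F P.
Proof.
move=> df dF; have dfd := df; move/derivable1_diffP: dfd => dfd.
rewrite /partial deriveE; last exact: (@differentiable_comp _ _ _ _ F f).
rewrite (diff_comp dF dfd) [LHS]/= (deriv1E df) deriveE; last exact: dF.
exact: mulrC.
Qed.

Lemma partial0_cst F : (forall P, differentiable F P) ->
  (forall i P, partial i F P = 0) -> forall P Q, F P = F Q.
Proof.
move=> dF F0 P Q.
have h (t : R) : is_derive t 1 (fun t : R => F (P + t *: (Q - P))) 0.
  have hF : derivable F (P + t *: (Q - P)) (Q - P) by exact: diff_derivable.
  have := @is_derive_line F P (Q - P) t hF.
  rewrite deriveE; last exact: dF.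
  rewrite diff_partial; last exact: dF.
  by rewrite big1 => [//|i _]; rewrite F0 scaler0.
have := @is_derive_0_is_cst R _ 0 1 h.
by rewrite scale0r addr0 scale1r addrC subrK.
Qed.

Lemma partial_mx m (F : 'rV[R]_n -> 'rV[R]_m) (k : 'I_m) i P : differentiable F P ->
  partial i (fun Q => F Q 0 k) P = partial i F P 0 k.
Proof.
move=> dF; rewrite [in RHS]/partial derive_mx; last exact: diff_derivable.
by rewrite mxE.
Qed.

Lemma smooth_mx m (F : 'rV[R]_n -> 'rV[R]_m) (k : 'I_m) : smooth F ->
  smooth (fun Q => F Q 0 k : R).
Proof.
move=> sF s P.
have -> : foldr (@partial R n _) (fun Q => F Q 0 k : R) s =
    fun Q => foldr (@partial R n _) F s Q 0 k.
  by elim: s => //= i s ->; apply/funext => Q; rewrite partial_mx.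
apply: (@differentiable_comp _ _ _ _ _ (fun N : 'rV[R]_m => N 0 k : R)) => //.
exact: differentiable_coord.
Qed.

End SecondDerivatives.

(** * Rigidity of isometries *)

Section Rigidity.
Context {R : realType}.
Implicit Types (f : R -> R) (P Q : 'rV[R]_4) (i j k m : 'I_4).

Lemma ipC f P (u v : 'rV[R]_4) : ip (Mf f P) u v = ip (Mf f P) v u.
Proof. by rewrite !ip_Mf; ring. Qed.

Lemma ip_delta f P i j : ip (Mf f P) 'e_i 'e_j = Mf f P i j.
Proof.
rewrite ip_Mf !mxE; elim/ord4_ind: i; elim/ord4_ind: j => /=; ring.
Qed.

(* [D i] and [D2 i j] stand for d_i phi and d_i d_j phi at a point P, for an
   isometry phi from [Mf f1] to [Mf f2] with phi(P) = Q: by the Koszul formula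
   phi intertwines the Levi-Civita connections. *)
Lemma gauss_formula f1 f2 P Q (D : 'I_4 -> 'rV[R]_4) (D2 : 'I_4 -> 'I_4 -> 'rV[R]_4)
    (df1 df2 : R) :
  (forall i j, ip (Mf f2 Q) (D i) (D j) = Mf f1 P i j) ->
  (forall i j, D2 i j = D2 j i) ->
  (forall m i j, (m == i1)%:R * (i == i0)%:R * (j == i0)%:R * (- 2 * df1) =
     ip (Mf f2 Q) (D2 m i) (D j) + ip (Mf f2 Q) (D i) (D2 m j)
     - 2 * df2 * D m 0 i1 * D i 0 i0 * D j 0 i0) ->
  forall i j k, D2 i j 0 k =
    df1 * (christoffel_coef i j i3 * D i3 0 k + christoffel_coef i j i2 * D i2 0 k)
    + (k == i2)%:R * df2 * (D i 0 i0 * D j 0 i1 + D i 0 i1 * D j 0 i0)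
    - (k == i3)%:R * df2 * (D i 0 i0 * D j 0 i0).
Proof.
move=> hE hS hD i j.
pose B := ip (Mf f2 Q).
(* Koszul's trick: the combination (i, j, k) + (j, i, k) - (k, i, j) of the differentiated metric
   identities isolates the second derivative. *)
have koszul k : B (D2 i j) (D k) =
    df1 * (christoffel_coef i j i3 * (k == i1)%:R + christoffel_coef i j i2 * (k == i0)%:R)
    + df2 * (D i 0 i1 * D j 0 i0 * D k 0 i0 + D j 0 i1 * D i 0 i0 * D k 0 i0
             - D k 0 i1 * D i 0 i0 * D j 0 i0).
  have h1 := hD i j k; have h2 := hD j i k; have h3 := hD k i j.
  rewrite (hS k i) (hS k j) in h3; rewrite (hS j i) in h2.
  rewrite -!/B (ipC _ _ (D j) (D2 i k) : B _ _ = B _ _) in h1.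
  rewrite -!/B (ipC _ _ (D i) (D2 j k) : B _ _ = B _ _) in h2.
  rewrite -!/B (ipC _ _ (D i) (D2 j k) : B _ _ = B _ _) in h3.
  have -> : B (D2 i j) (D k) = 2^-1 *
    ((i == i1)%:R * (j == i0)%:R * (k == i0)%:R * (- 2 * df1)
     + (j == i1)%:R * (i == i0)%:R * (k == i0)%:R * (- 2 * df1)
     - (k == i1)%:R * (i == i0)%:R * (j == i0)%:R * (- 2 * df1))
    + df2 * (D i 0 i1 * D j 0 i0 * D k 0 i0 + D j 0 i1 * D i 0 i0 * D k 0 i0
             - D k 0 i1 * D i 0 i0 * D j 0 i0).
    by rewrite h1 h2 h3; field.
  by rewrite /christoffel_coef /=; field.
(* [- t] is the target connection evaluated on [D i] and [D j], and [w] below measures how far phi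
   is from intertwining the two connections. *)
pose t : 'rV[R]_4 := \row_k ((k == i2)%:R * df2 * (D i 0 i0 * D j 0 i1 + D i 0 i1 * D j 0 i0)
    - (k == i3)%:R * df2 * (D i 0 i0 * D j 0 i0)).
pose w := D2 i j - df1 *: (christoffel_coef i j i3 *: D i3 + christoffel_coef i j i2 *: D i2) - t.
have hw k : B w (D k) = 0.
  have -> : B w (D k) = B (D2 i j) (D k)
     - df1 * (christoffel_coef i j i3 * B (D i3) (D k) + christoffel_coef i j i2 * B (D i2) (D k))
     - (t 0 i2 * D k 0 i0 + t 0 i3 * D k 0 i1).
    by rewrite /B !ip_Mf /w !mxE /=; ring.
  rewrite koszul /B !hE !mxE /=.
  by elim/ord4_ind: k => /=; ring.
(* [w] is orthogonal to every [D k], and these form a frame because their Gram matrix [Mf f1 P] is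
   invertible. *)
have w0 : w = 0.
  pose J : 'M[R]_4 := \matrix_(k, l) D k 0 l.
  have rowJ k : row k J = D k by apply/rowP => l; rewrite !mxE.
  have JG : J *m (Mf f2 Q *m J^T) = Mf f1 P.
    apply/matrixP => k l; rewrite -hE /ip -!rowJ mulmxA -row_mul [LHS]mxE [RHS]mxE.
    by apply: eq_bigr => s _; congr (_ * _); rewrite !mxE.
  have wG : w *m (Mf f2 Q *m J^T) = 0.
    apply/rowP => l; rewrite [RHS]mxE -(hw l) /B /ip -rowJ mulmxA.
    by rewrite [LHS]mxE [RHS]mxE; apply: eq_bigr => s _; rewrite !mxE.
  have : Mf f2 Q *m J^T \in unitmx.
    have := mulmx1_unit (mulmx_Mf_inv f1 P).
    by rewrite -JG unitmx_mul => -[/andP[_ ->]].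
  by move=> u; rewrite -(mulmxK u w) wG mul0mx.
move=> k.
have : w 0 k = 0 by rewrite w0 mxE.
rewrite /w !mxE => /eqP; rewrite !subr_eq add0r => /eqP ->.
by ring.
Qed.

(** The product rule for a coefficient of the pulled-back metric: [g] stands for f2 composed with
    the y-component of the isometry, and the [a] and [b] families for the components of two of its
    partial derivatives. *)
Lemma partial_metric (g a0 a1 a2 a3 b0 b1 b2 b3 : 'rV[R]_4 -> R) P (v : 'rV[R]_4)
   (g' a0' a1' a2' a3' b0' b1' b2' b3' : R) :
  is_derive P v g g' ->
  is_derive P v a0 a0' -> is_derive P v a1 a1' ->
  is_derive P v a2 a2' -> is_derive P v a3 a3' ->
  is_derive P v b0 b0' -> is_derive P v b1 b1' ->
  is_derive P v b2 b2' -> is_derive P v b3 b3' ->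
  'D_v (fun Q => - 2 * g Q * a0 Q * b0 Q + a0 Q * b2 Q + a2 Q * b0 Q
           + a1 Q * b3 Q + a3 Q * b1 Q) P =
  - 2 * g P * a0' * b0 P + a0' * b2 P + a2' * b0 P + a1' * b3 P + a3' * b1 P
  + (- 2 * g P * a0 P * b0' + a0 P * b2' + a2 P * b0' + a1 P * b3' + a3 P * b1')
  - 2 * g' * a0 P * b0 P.
Proof.
move=> hg ha0 ha1 ha2 ha3 hb0 hb1 hb2 hb3.
have h1 := is_deriveM (is_deriveM (is_deriveZ (- 2) hg) ha0) hb0.
have h2 := is_deriveD (is_deriveD h1 (is_deriveM ha0 hb2)) (is_deriveM ha2 hb0).
have h3 := is_deriveD (is_deriveD h2 (is_deriveM ha1 hb3)) (is_deriveM ha3 hb1).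
transitivity (- 2 * g P * a0 P * b0' + b0 P * (- 2 * g P * a0' + a0 P * (- 2 * g'))
   + (a0 P * b2' + b2 P * a0') + (a2 P * b0' + b0 P * a2')
   + (a1 P * b3' + b3 P * a1') + (a3 P * b1' + b1 P * a3')).
  exact: (@derive_val _ _ _ _ _ _ _ h3).
by ring.
Qed.

(** The product rule for the right-hand side of the second order system satisfied by one component
    of an isometry. *)
Lemma partial_hessian (g h A B : 'rV[R]_4 -> R) P (v : 'rV[R]_4)
   (c2 c3 x g' h' A' B' : R) :
  is_derive P v g g' -> is_derive P v h h' ->
  is_derive P v A A' -> is_derive P v B B' ->
  'D_v (fun Q => g Q * (c3 * A Q + c2 * B Q) - h Q * x) P =
  g' * (c3 * A P + c2 * B P) + g P * (c3 * A' + c2 * B') - h' * x.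
Proof.
move=> hg hh hA hB.
have h1 := is_deriveM hg (is_deriveD (is_deriveZ c3 hA) (is_deriveZ c2 hB)).
have h2 := is_deriveB h1 (is_deriveZ x hh).
have E : g * (c3 *: A + c2 *: B) - x *: h = fun Q => g Q * (c3 * A Q + c2 * B Q) - h Q * x.
  by apply/funext => Q; rewrite (mulrC (h Q)).
transitivity (g P * (c3 * A' + c2 * B') + (c3 * A P + c2 * B P) * g' - x * h').
  rewrite -E; exact: (@derive_val _ _ _ _ _ _ _ h2).
by ring.
Qed.

Lemma is_derive_partial (F : 'rV[R]_4 -> R) P i : differentiable F P ->
  is_derive P 'e_i F (partial i F P).
Proof. by move=> dF; apply: DeriveDef => //; exact: diff_derivable. Qed.

Lemma differentiable_ycoord P : differentiable (@ycoord R) P.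
Proof. exact: differentiable_coord. Qed.

Lemma differentiable_comp1 f (F : 'rV[R]_4 -> R) P : derivable f (F P) 1 ->
  differentiable F P -> differentiable (fun Q => f (F Q)) P.
Proof.
move=> /derivable1_diffP df dF.
exact: (@differentiable_comp _ _ _ _ F f).
Qed.

(* [A j] is the j-th partial derivative of a component of an isometry; the
   conclusion is d_0 d_1 (A j) = d_1 d_0 (A j) for j = 0 and j = 1. *)
Lemma hessian_integrability f1 f2 (A : 'I_4 -> 'rV[R]_4 -> R) (Y : 'rV[R]_4 -> R) (x b : 'I_4 -> R) :
  (forall n (y : R), derivable (derive1n n f1) y 1) ->
  (forall n (y : R), derivable (derive1n n f2) y 1) ->
  (forall j, smooth (A j)) -> (forall P, differentiable Y P) ->
  (forall i P, partial i Y P = b i) -> x i2 = 0 -> x i3 = 0 ->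
  (forall i j P, partial i (A j) P =
     derive1 f1 (ycoord P) *
       (christoffel_coef i j i3 * A i3 P + christoffel_coef i j i2 * A i2 P)
     - derive1 f2 (Y P) * (x i * x j)) ->
  forall P,
  derive1n 2 f1 (ycoord P) * A i3 P
    = derive1n 2 f2 (Y P) * x i0 * (x i0 * b i1 - x i1 * b i0) /\
  derive1n 2 f1 (ycoord P) * A i2 P
    = - (derive1n 2 f2 (Y P) * x i1 * (x i0 * b i1 - x i1 * b i0)).
Proof.
move=> df1 df2 sA dY hY x2 x3 H P.
have dA j Q : differentiable (A j) Q := sA j [::] Q.
have H2 m i j : partial m (partial i (A j)) P =
    (m == i1)%:R * derive1n 2 f1 (ycoord P) *
      (christoffel_coef i j i3 * A i3 P + christoffel_coef i j i2 * A i2 P)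
    - derive1n 2 f2 (Y P) * b m * (x i * x j).
  rewrite (_ : partial i (A j) = fun Q => derive1 f1 (ycoord Q) *
       (christoffel_coef i j i3 * A i3 Q + christoffel_coef i j i2 * A i2 Q)
     - derive1 f2 (Y Q) * (x i * x j)); last by apply/funext => Q; exact: H.
  (* [A i3] and [A i2] behave as constants: no symbol has a lower index x~ or y~, and [x i3] and
     [x i2] vanish. *)
  have A3 : partial m (A i3) P = 0.
    by rewrite H x3 /christoffel_coef /= !(mulr0, mul0r, addr0, subr0).
  have A2 : partial m (A i2) P = 0.
    by rewrite H x2 /christoffel_coef /= !(mulr0, mul0r, addr0, subr0).
  have hg : is_derive P 'e_m (fun Q => derive1 f1 (ycoord Q)) ((m == i1)%:R * derive1n 2 f1 (ycoord P)).
    have -> : (m == i1)%:R * derive1n 2 f1 (ycoord P) =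
        partial m (fun Q => derive1 f1 (ycoord Q)) P.
      by rewrite (partial_ycoord (derive1 f1)).
    apply: is_derive_partial; apply: differentiable_comp1; first exact: (df1 1%N).
    exact: differentiable_ycoord.
  have hh : is_derive P 'e_m (fun Q => derive1 f2 (Y Q)) (derive1n 2 f2 (Y P) * b m).
    have -> : derive1n 2 f2 (Y P) * b m = partial m (fun Q => derive1 f2 (Y Q)) P.
      rewrite (partial_comp (derive1 f2) Y) ?hY//; exact: (df2 1%N).
    apply: is_derive_partial; apply: differentiable_comp1; first exact: (df2 1%N).
    exact: dY.
  have hA : is_derive P 'e_m (A i3) 0 by rewrite -A3; exact: is_derive_partial.
  have hB : is_derive P 'e_m (A i2) 0 by rewrite -A2; exact: is_derive_partial.
  rewrite /partial (@partial_hessian _ _ _ _ P 'e_m _ _ _ _ _ _ _ hg hh hA hB).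
  by rewrite !mulr0 addr0 mulr0 addr0.
have e0 := partialC (A i0) i1 i0 P (sA i0).
have e1 := partialC (A i1) i1 i0 P (sA i1).
move: e0 e1; rewrite !H2 /christoffel_coef.
move: (derive1n 2 f1 _) (derive1n 2 f2 _) (A i3 P) (A i2 P) (x i0) (x i1) (b i0) (b i1).
by clear=> F G a3 a2 x0 x1 b0 b1 /= e0 e1; split; [move: e0|move: e1]; clear=> e; lra.
Qed.

(** The first four equations say that the x, y Jacobian of (X, Y) and the x~, y~ Jacobian of (X~,
    Y~) are inverse up to transposition. Hence d w2 = - x1 and d w3 = x0 with [d] the determinant of
    the former; substitution in the last two equations gives the claim. *)
Lemma rigidity_algebra (F G x0 x1 y0 y1 z2 z3 w2 w3 : R) :
  x0 * z2 + y0 * w2 = 1 -> x0 * z3 + y0 * w3 = 0 ->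
  x1 * z2 + y1 * w2 = 0 -> x1 * z3 + y1 * w3 = 1 ->
  F * w3 = G * x0 * (x0 * y1 - x1 * y0) ->
  F * w2 = - (G * x1 * (x0 * y1 - x1 * y0)) ->
  F = G * (x0 * y1 - x1 * y0) ^+ 2.
Proof.
move=> e02 e03 e12 e13 hw3 hw2; set d := x0 * y1 - x1 * y0.
have dw2 : d * w2 = - x1.
  transitivity (x0 * (x1 * z2 + y1 * w2) - x1 * (x0 * z2 + y0 * w2)).
    by rewrite /d; ring.
  by rewrite e12 e02; ring.
have dw3 : d * w3 = x0.
  transitivity (x0 * (x1 * z3 + y1 * w3) - x1 * (x0 * z3 + y0 * w3)).
    by rewrite /d; ring.
  by rewrite e13 e03; ring.
transitivity (z2 * (d * (F * w3)) + y0 * (F * w2)).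
  by rewrite -[LHS]mulr1 -e02 -[in LHS]dw3; ring.
rewrite hw3 hw2 -/d.
transitivity (G * d ^+ 2 * (x0 * z2 + y0 * w2) + G * d * y0 * (- x1 - d * w2)).
  by ring.
by rewrite e02 dw2; ring.
Qed.

End Rigidity.

(** * The invariants alpha *)

Section Equivalence.
Context {R : realType}.
Implicit Types (f : R -> R) (P Q : 'rV[R]_4) (i j k m : 'I_4).

Lemma partialE (n : nat) (W : normedModType R) (F : 'rV[R]_n -> W) (i : 'I_n) (Q : 'rV[R]_n) :
  partial i F Q = 'D_('e_i) F Q.
Proof. by []. Qed.

Local Opaque partial.

Lemma isometry_derivatives f1 f2 (phi : 'rV[R]_4 -> 'rV[R]_4) :
  (forall n (y : R), derivable (derive1n n f1) y 1) ->
  (forall n (y : R), derivable (derive1n n f2) y 1) ->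
  (forall y, 0 < derive1n 2 f1 y) ->
  metric_isometry (Mf f1) (Mf f2) phi ->
  exists c d : R, forall n P,
    derive1n n.+2 f1 (ycoord P) = c * d ^+ n * derive1n n.+2 f2 (ycoord (phi P)).
Proof.
move=> df1 df2 f1_gt0 [sphi _ iso].
pose c k : 'rV[R]_4 -> R := fun Q => phi Q 0 k.
pose D i := partial i phi; pose D2 i j := partial i (partial j phi).
have sc k : smooth (c k) by exact: smooth_mx.
have dpc i k Q : differentiable (partial i (c k)) Q by exact: (sc k [:: i] Q).
have DE i k P : D i P 0 k = partial i (c k) P.
  by rewrite -partial_mx//; exact: (sphi [::] P).
have D2E m i k P : D2 m i P 0 k = partial m (partial i (c k)) P.
  rewrite -partial_mx; last exact: (sphi [:: i] P).
  by have -> : (fun Q => partial i phi Q 0 k) = partial i (c k) by apply/funext => Q; exact: DE.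
have E i j P : ip (Mf f2 (phi P)) (D i P) (D j P) = Mf f1 P i j.
  by rewrite -(ip_delta f1) -iso /D !partialE !deriveE//; exact: (sphi [::] P).
have cE Q : ycoord (phi Q) = c i1 Q by exact: ycoordE.
move: c D D2 sc dpc DE D2E E cE; clear iso sphi => c D D2 sc dpc DE D2E E cE.
have S P i j : D2 i j P = D2 j i P.
  apply/rowP => k; rewrite (D2E i j k) (D2E j i k).
  exact (partialC (c k) i j P (sc k)).
have dE P m i j : (m == i1)%:R * (i == i0)%:R * (j == i0)%:R * (- 2 * derive1 f1 (ycoord P)) =
    ip (Mf f2 (phi P)) (D2 m i P) (D j P)
    + ip (Mf f2 (phi P)) (D i P) (D2 m j P)
    - 2 * derive1 f2 (ycoord (phi P)) * D m P 0 i1 * D i P 0 i0 * D j P 0 i0.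
  rewrite -(partial_Mf f1 m i j P (df1 0%N)).
  have -> : (fun Q => Mf f1 Q i j) = fun Q => - 2 * f2 (c i1 Q) * partial i (c i0) Q * partial j (c i0) Q
     + partial i (c i0) Q * partial j (c i2) Q + partial i (c i2) Q * partial j (c i0) Q
     + partial i (c i1) Q * partial j (c i3) Q + partial i (c i3) Q * partial j (c i1) Q.
    by apply/funext => Q; rewrite -(E i j Q) ip_Mf cE !(DE i) !(DE j).
  have dc l k : is_derive P 'e_m (partial l (c k)) (partial m (partial l (c k)) P).
    exact: is_derive_partial.
  have df : is_derive P 'e_m (fun Q => f2 (c i1 Q)) (derive1 f2 (c i1 P) * partial m (c i1) P).
    rewrite -(partial_comp f2 (c i1) m P (df2 0%N _) (sc i1 [::] P)).
    apply: is_derive_partial; apply: differentiable_comp1; first exact: (df2 0%N).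
    exact: (sc i1 [::] P).
  rewrite partialE (@partial_metric R (fun Q => f2 (c i1 Q)) _ _ _ _ _ _ _ _ P 'e_m _ _ _ _ _ _ _ _ _
     df (dc i i0) (dc i i1) (dc i i2) (dc i i3) (dc j i0) (dc j i1) (dc j i2) (dc j i3)).
  rewrite !ip_Mf cE !(DE i) !(DE j) (DE m) !(D2E m i) !(D2E m j).
  by rewrite [2 * (derive1 f2 _ * _)]mulrA.
have H P := gauss_formula f1 f2 P (phi P) (fun i => D i P)
  (fun i j => D2 i j P) _ _ (fun i j => E i j P) (S P) (dE P).
have spc j k : smooth (partial j (c k)) by exact: smooth_partial.
(* The target connection has no X or Y component, so the integrability conditions apply with zero
   source terms; since f1'' is non-zero, X and Y do not depend on x~ and y~. *)
have flat k : k == i0 \/ k == i1 ->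
    forall P, partial i3 (c k) P = 0 /\ partial i2 (c k) P = 0.
  move=> k01 P.
  have [|||] := @hessian_integrability R f1 f1 (fun j => partial j (c k)) (cst 0)
    (fun _ => 0) (fun _ => 0) df1 df1 (fun j => spc j k) _ _ erefl erefl _ P.
  - by move=> Q; exact: differentiable_cst.
  - by move=> i Q; rewrite partialE; exact: derive_cst.
  - move=> i j Q; rewrite -D2E H !DE.
    by case: k01 => /eqP -> /=; rewrite !mul0r mulr0 !subr0 addr0.
  have : derive1n 2 f1 (ycoord P) != 0 by rewrite gt_eqF.
  move: (derive1n 2 f1 (ycoord P)) (derive1n 2 f1 _) (partial i3 (c k) P) (partial i2 (c k) P).
  clear=> F G u v F0; rewrite !mulr0 !mul0r oppr0 => h3 h2.
  by split; apply: (mulfI F0); rewrite mulr0.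
(* The system for X and Y only involves their x~ and y~ derivatives, so all second derivatives
   vanish and X and Y are affine. *)
have hess0 k : k == i0 \/ k == i1 -> forall i j P, partial i (partial j (c k)) P = 0.
  move=> k01 i j P; have [z3 z2] := flat _ k01 P; rewrite -D2E H !DE z2 z3.
  by case: k01 => /eqP -> /=; rewrite !mulr0 addr0 mulr0 !mul0r !subr0 addr0.
have ccst k : k == i0 \/ k == i1 -> forall j P, partial j (c k) P = partial j (c k) 0.
  move=> k01 j P; apply: partial0_cst => [Q|i Q]; first exact: dpc.
  exact: hess0.
have k0 : i0 == i0 \/ i0 == i1 by left.
have k1 : i1 == i0 \/ i1 == i1 by right.
pose x j := partial j (c i0) 0; pose b j := partial j (c i1) 0.
have cX j P : partial j (c i0) P = x j by exact: ccst.
have cB j P : partial j (c i1) P = b j by exact: ccst.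
have [x3 x2] : x i3 = 0 /\ x i2 = 0 by exact: (flat i0 k0 0).
have [b3 b2] : b i3 = 0 /\ b i2 = 0 by exact: (flat i1 k1 0).
(* For Y~ the target connection contributes only - f2' (Y) times a product of derivatives of X, now
   constants. *)
have hW := @hessian_integrability R f1 f2 (fun j => partial j (c i3)) (c i1) x b
  df1 df2 (fun j => spc j i3) (sc i1 [::]) cB x2 x3.
have key P : derive1n 2 f1 (ycoord P) =
    derive1n 2 f2 (c i1 P) * (x i0 * b i1 - x i1 * b i0) ^+ 2.
  have [i j Q|h3 h2] := hW _ P.
    rewrite -D2E H !DE !cX /= cE mul0r mul0r addr0 mul1r.
    by [].
  have e02 := E i0 i2 P; have e03 := E i0 i3 P.
  have e12 := E i1 i2 P; have e13 := E i1 i3 P.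
  move: h3 h2; cbv beta; move: (derive1n 2 f1 _) (derive1n 2 f2 _) => F G.
  move: e02 e03 e12 e13; rewrite !ip_Mf !DE !cX !cB x2 x3 b2 b3 !mxE.
  move: (f2 _) (partial i2 (c i2) P) (partial i3 (c i2) P) (partial i2 (c i3) P) (partial i3 (c i3) P)
    (partial i0 (c i2) P) (partial i1 (c i2) P) (partial i0 (c i3) P) (partial i1 (c i3) P).
  move: (x i0) (x i1) (b i0) (b i1); clear=> x0 x1 y0 y1 h z2 z3 w2 w3 z0 z1 w0 w1 /=.
  rewrite !mulr0 !add0r !addr0 => e02 e03 e12 e13.
  exact: rigidity_algebra e02 e03 e12 e13.
(* [c] is the squared Jacobian determinant of (X, Y), and [d] is the derivative of Y in y: each
   differentiation in y yields one factor [b i1] by the chain rule. *)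
exists ((x i0 * b i1 - x i1 * b i0) ^+ 2), (b i1).
elim=> [|n IH] P; first by rewrite key mulr1 mulrC cE.
transitivity (partial i1 (fun Q => derive1n n.+2 f1 (ycoord Q)) P).
  by rewrite (partial_ycoord (derive1n n.+2 f1)) mul1r.
set C := _ ^+ 2 in IH *.
pose g y := C * b i1 ^+ n * derive1n n.+2 f2 y.
have dg y : derivable g y 1 by apply: derivableZ; exact: df2.
have -> : (fun Q => derive1n n.+2 f1 (ycoord Q)) = fun Q => g (c i1 Q).
  by apply/funext => Q; rewrite IH cE.
rewrite (partial_comp g (c i1) i1 P (dg _) (sc i1 [::] P)).
rewrite /g derive1Ml; last exact: df2.
by rewrite cB cE exprSr mulrA [LHS]mulrAC.
Qed.

(** Under f'' -> c f'' and f''' -> c d f''', the factor {f''}^(p-1) {f'''}^(-p) of alpha_p is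
    multiplied by c^(-1) d^(-p). *)
Lemma alpha_factor (c d u0 u1 v0 v1 : R) p : (0 < p)%N ->
  c != 0 -> d != 0 -> v0 != 0 -> v1 != 0 -> u0 = c * v0 -> u1 = c * d * v1 ->
  v0 ^+ (p - 1) * v1 ^- p = c * d ^+ p * (u0 ^+ (p - 1) * u1 ^- p).
Proof.
case: p => // p _ c0 d0 v00 v10 -> ->; rewrite subn1 /= !exprMn !exprS.
have := expf_neq0 p c0; have := expf_neq0 p d0; have := expf_neq0 p v10.
move: (c ^+ p) (d ^+ p) (v0 ^+ p) (v1 ^+ p) => cp dp v0p v1p h1 h2 h3.
by field; rewrite c0 d0 v10 h1 h2 h3.
Qed.

(** Serves both directions of (3): once orders 2 and 3 scale by c and c d, equality of alpha_p is
    the scaling law for the derivative of order p + 2. *)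
Lemma alpha_eqP (c d u0 u1 up v0 v1 vp : R) p : (0 < p)%N ->
  c != 0 -> d != 0 -> v0 != 0 -> v1 != 0 -> u0 = c * v0 -> u1 = c * d * v1 ->
  up * (u0 ^+ (p - 1) * u1 ^- p) = vp * (v0 ^+ (p - 1) * v1 ^- p)
  <-> up = c * d ^+ p * vp.
Proof.
move=> p0 c0 d0 v00 v10 e0 e1.
have -> : vp * (v0 ^+ (p - 1) * v1 ^- p) = c * d ^+ p * vp * (u0 ^+ (p - 1) * u1 ^- p).
  by rewrite (alpha_factor c d u0 u1 v0 v1 p)// mulrCA mulrA.
split=> [|->] //; apply: mulIf.
by rewrite e0 e1 mulf_neq0 ?invr_neq0 ?expf_neq0 ?mulf_neq0.
Qed.

Lemma alphaE p f (y : R) : alpha p f y =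
  derive1n p.+2 f y * (derive1n 2 f y ^+ (p - 1) * derive1n 3 f y ^- p).
Proof. by rewrite /alpha addn2 mulrA. Qed.

Lemma alpha_isometry f1 f2 phi P p : C3 f1 -> C3 f2 ->
  metric_isometry (Mf f1) (Mf f2) phi -> (0 < p)%N ->
  alpha p f1 (ycoord P) = alpha p f2 (ycoord (phi P)).
Proof.
move=> [a1 f1_2 f1_3] [a2 f2_2 f2_3] iso p0.
have [||//|c [d H]] := isometry_derivatives _ _ _ _ _ _ iso.
- by move=> n y; apply: real_analytic_derivable; exact: real_analytic_derive1n.
- by move=> n y; apply: real_analytic_derivable; exact: real_analytic_derive1n.
have h0 := H 0%N P; have h1 := H 1%N P; have hp := H p P.
rewrite expr0 mulr1 in h0; rewrite expr1 in h1.
have u0 := f1_2 (ycoord P); have u1 := f1_3 (ycoord P).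
have v0 := f2_2 (ycoord (phi P)); have v1 := f2_3 (ycoord (phi P)).
rewrite !alphaE; clear H; move: hp h0 h1 u0 u1 v0 v1.
move: (derive1n p.+2 f1 _) (derive1n p.+2 f2 _) => up vp.
move: (derive1n 2 f1 _) (derive1n 3 f1 _) (derive1n 2 f2 _) (derive1n 3 f2 _) => x0 x1 y0 y1.
move=> hp h0 h1 u0 u1 v0 v1.
(* [c] and [d] cannot vanish because f1''' is positive. *)
have cd : c * d != 0 by apply: contraTneq u1 => cd; rewrite h1 cd mul0r ltxx.
have /andP[c0 d0] : (c != 0) && (d != 0) by move: cd; rewrite mulf_eq0 negb_or.
by apply/(alpha_eqP c d) => //; rewrite gt_eqF.
Qed.

Lemma affine_of_derive2 f :
  (forall y : R, derivable f y 1) -> (forall y : R, derivable (derive1 f) y 1) ->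
  (forall y, derive1 (derive1 f) y = 0) -> exists b c : R, forall y, f y = b * y + c.
Proof.
move=> df d2f f2; pose b := derive1 f 0; exists b, (f 0) => y.
have hb z : derive1 f z = b.
  apply: (@is_derive_0_is_cst R (derive1 f) z 0) => t.
  by apply: DeriveDef; [exact: d2f|rewrite -derive1E].
have h (t : R) : is_derive t 1 (f - b *: id) 0.
  have df1 : is_derive t 1 f b by apply: DeriveDef; [exact: df|rewrite -derive1E].
  rewrite -(subrr b) -[X in _ (_ - X)]mulr1.
  exact: is_deriveB.
have : f y - b * y = f 0 - b * 0 := @is_derive_0_is_cst R _ y 0 h.
by rewrite mulr0 subr0 => <-; rewrite addrC subrK.
Qed.

Lemma derive1n_derive2 f n : derive1n n (derive1n 2 f) = derive1n n.+2 f.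
Proof. by rewrite /derive1n -iterD addn2. Qed.

(** Orders 2 and 3 determine [a] and [d], the invariants fix all higher orders at [y1], and the
    identity theorem for f1'' followed by two integrations gives f1 up to an affine term. *)
Lemma alpha_affine f1 f2 (y1 y2 : R) : C3 f1 -> C3 f2 ->
  (forall p, (2 <= p)%N -> alpha p f1 y1 = alpha p f2 y2) ->
  exists a d b c : R, [/\ a != 0, d != 0 &
    forall y, f1 y = a ^+ 2 * f2 (d * y + (y2 - d * y1)) + b * y + c].
Proof.
move=> [a1 f1_2 f1_3] [a2 f2_2 f2_3] Halpha.
have df1 n (y : R) : derivable (derive1n n f1) y 1.
  by apply: real_analytic_derivable; exact: real_analytic_derive1n.
have df2 n (y : R) : derivable (derive1n n f2) y 1.
  by apply: real_analytic_derivable; exact: real_analytic_derive1n.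
have u0 := f1_2 y1; have u1 := f1_3 y1; have v0 := f2_2 y2; have v1 := f2_3 y2.
have [a [d [a0 d0 A B]]] := frame_scaling _ _ (divr_gt0 u0 v0) (divr_gt0 u1 v1).
pose C := a ^+ 2 * d ^+ 2; pose e := y2 - d * y1.
have C0 : C != 0 by rewrite mulf_neq0// expf_neq0.
have n0 (z : R) : 0 < z -> z != 0 by move=> z0; rewrite gt_eqF.
have E0 : derive1n 2 f1 y1 = C * derive1n 2 f2 y2.
  by rewrite /C A divfK//; exact: n0.
have E1 : derive1n 3 f1 y1 = C * d * derive1n 3 f2 y2.
  have -> : C * d = a ^+ 2 * d ^+ 3 by rewrite /C; ring.
  by rewrite B divfK//; exact: n0.
have En n : derive1n n.+2 f1 y1 = C * d ^+ n * derive1n n.+2 f2 y2.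
  (* Orders 2 and 3 match by the choice of [a] and [d]; from order 4 on the hypothesis on alpha is
     used. *)
  case: n => [|[|n]]; [by rewrite expr0 mulr1|by rewrite expr1|].
  have := Halpha n.+2 isT; rewrite (alphaE n.+2 f1 y1) (alphaE n.+2 f2 y2) => H.
  exact (proj1 (alpha_eqP C d _ _ _ _ _ _ n.+2 isT C0 d0 (n0 _ v0) (n0 _ v1) E0 E1) H).
have F2 : derive1n 2 f1 = fun t => C * derive1n 2 f2 (d * t + e).
  apply: (real_analytic_eq _ _ y1).
  - exact: real_analytic_derive1n.
  - by apply: real_analytic_affine; exact: real_analytic_derive1n.
  move=> n; rewrite (@derive1n_affine R (derive1n 2 f2) C d e y1 n); last first.
    by move=> m z; rewrite derive1n_derive2; exact: df2.
  have ye : d * y1 + e = y2 by rewrite /e addrC subrK.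
  have e1 : derive1n n (derive1n 2 f1) y1 = derive1n n.+2 f1 y1.
    rewrite derive1n_derive2; reflexivity.
  have e2 : derive1n n (derive1n 2 f2) (d * y1 + e) = derive1n n.+2 f2 y2.
    rewrite derive1n_derive2 ye; reflexivity.
  exact (etrans e1 (etrans (En n) (congr1 (GRing.mul (C * d ^+ n)) (esym e2)))).
(* [g] has second derivative f1'', so [f1 - g] is affine. *)
pose g t := a ^+ 2 * f2 (d * t + e).
have dg n y : derive1n n g y = a ^+ 2 * d ^+ n * derive1n n f2 (d * y + e).
  exact: derive1n_affine.
have ag : real_analytic g by exact: real_analytic_affine.
have ag1 : real_analytic (derive1 g) by exact: real_analytic_derive1.
have dfg : derive1 (f1 - g) = derive1 f1 - derive1 g.
  apply/funext => y; rewrite derive1E deriveB; [|exact: (df1 0%N)|exact: real_analytic_derivable].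
  by rewrite -!derive1E.
have [||y|b [c H]] := affine_of_derive2 (f1 - g).
- by move=> y; apply: derivableB; [exact: (df1 0%N)|exact: real_analytic_derivable].
- move=> y; rewrite dfg; apply: derivableB; [exact: (df1 1%N)|exact: real_analytic_derivable].
- rewrite dfg derive1E deriveB; [|exact: (df1 1%N)|exact: real_analytic_derivable].
  rewrite -!derive1E; have := dg 2%N y; rewrite derive1nS derive1n1 => ->.
  have := congr1 (fun h => h y) F2; rewrite /= => ->.
  exact: subrr.
exists a, d, b, c; split=> // y.
have : f1 y - g y = b * y + c by exact: H.
by move=> /eqP; rewrite subr_eq => /eqP ->; rewrite /g /e addrC addrA.
Qed.

End Equivalence.

Theorem theorem1p6 (R : realType) :
  (forall f : R -> R, C2 f ->
     [/\ irreducible (Mf (fun y : R => y ^+ 2)),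
         symmetric_space (Mf (fun y : R => y ^+ 2))
       & modeled_on 0 (Mf f) (Mf (fun y : R => y ^+ 2))])
  /\ (forall f : R -> R, C3 f -> modeled_on 1 (Mf f) (Mf (@expR R)))
  /\ (forall (f1 f2 : R -> R) (P1 P2 : 'rV[R]_4), C3 f1 -> C3 f2 ->
        ((exists phi : 'rV[R]_4 -> 'rV[R]_4,
            metric_isometry (Mf f1) (Mf f2) phi /\ phi P1 = P2)
         <->
         (forall p : nat, (2 <= p)%N ->
            alpha p f1 (ycoord P1) = alpha p f2 (ycoord P2)))).
Proof.
split; last split.
- move=> f hf; split; [exact: irreducible_sqr|exact: symmetric_space_sqr|].
  split; first exact: homogeneous_sqr.
  by exists 0; exact: C2_model.
- move=> f hf; split; first exact: homogeneous_expR.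
  by exists 0; exact: C3_model.
- move=> f1 f2 P1 P2 hf1 hf2; split.
    move=> [phi [iso <-]] p p2; apply: alpha_isometry => //; exact: ltnW.
  move=> /(alpha_affine _ _ _ _ hf1 hf2)[a [d [b [c [a0 d0 E]]]]].
  have [|phi iso phiP] := affine_isometry_ex _ _ _ _ _ _ _ P1 P2 a0 d0 E.
    by rewrite addrC subrK.
  by exists phi.
Qed.
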